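(* Let $(U_t)_{t\in\mathbb{R}}$ be a reflection positive unitary one-parameter group on the reflection positive Hilbert space $(\mathcal{E},\mathcal{E}_+,\theta)$ for which $\mathcal{E}_+$ is $U$-cyclic and $\mathcal{E}_{\rm fix}:=\{v\in\mathcal{E}: U_tv=v \text{ for all } t\in\mathbb{R}\}=\{0\}$. Then $\mathcal{E}_+$ is outgoing for $U$, so that $(U,\mathcal{E})$ is unitarily equivalent to the translation representation $(L_tf)(x)=f(x-t)$ on $L^2(\mathbb{R},\mathcal{M})$ for some Hilbert space $\mathcal{M}$ (the equivalence being an outgoing realization). This outgoing realization is unique up to isomorphism of $\mathcal{M}$.
   Context: A reflection positive Hilbert space is a triple $(\mathcal{E},\mathcal{E}_+,\theta)$, where $\mathcal{E}$ is a complex Hilbert space, $\theta$ is a unitary involution on $\mathcal{E}$ and $\mathcal{E}_+\subseteq\mathcal{E}$ is a closed subspace with $\langle\theta v,v\rangle\ge 0$ for all $v\in\mathcal{E}_+$. A reflection positive unitary one-parameter group on $(\mathcal{E},\mathcal{E}_+,\theta)$ is a strongly continuous unitary one-parameter group $(U_t)_{t\in\mathbb{R}}$ on $\mathcal{E}$ with $U_t\mathcal{E}_+\subseteq\mathcal{E}_+$ for $t>0$ and $\theta U_t\theta=U_{-t}$ for $t\in\mathbb{R}$. A subspace is $U$-cyclic if its translates under all $U_t$, $t\in\mathbb{R}$, span a dense subspace of $\mathcal{E}$. A closed subspace $\mathcal{E}_+\subseteq\mathcal{E}$ is called outgoing for $U$ if: (LP1) $U_t\mathcal{E}_+\subseteq\mathcal{E}_+$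 for $t>0$; (LP2) $\bigcap_{t>0}U_t\mathcal{E}_+=\{0\}$; (LP3) $\bigcup_{t<0}U_t\mathcal{E}_+$ is dense in $\mathcal{E}$. An outgoing realization of $(U,\mathcal{E})$ (with respect to $\mathcal{E}_+$) is a unitary isomorphism $\Phi:\mathcal{E}\to L^2(\mathbb{R},\mathcal{M})$, $\mathcal{M}$ a Hilbert space, with $\Phi(\mathcal{E}_+)=L^2([0,\infty[,\mathcal{M})$ and $\Phi\circ U_t=L_t\circ\Phi$ for all $t\in\mathbb{R}$. Uniqueness up to isomorphism of $\mathcal{M}$ means: for two such realizations $(\Phi,\mathcal{M})$ and $(\Phi',\mathcal{M}')$ there is a unitary isomorphism $V:\mathcal{M}\to\mathcal{M}'$ with $\Phi'=(\mathrm{id}_{L^2(\mathbb{R})}\otimes V)\circ\Phi$. *)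

(* Defs.v *)
From HB Require Import structures.
From mathcomp Require Import all_boot all_order all_algebra.
From mathcomp Require Import complex.
From mathcomp Require Import all_classical all_reals all_analysis.
From mathcomp Require Import measurable_realfun ring lra.
Set Implicit Arguments.
Unset Strict Implicit.
Unset Printing Implicit Defensive.
Import Order.TTheory GRing.Theory Num.Theory.
Import numFieldNormedType.Exports.
Local Open Scope classical_set_scope.
Local Open Scope complex_scope.
Local Open Scope ring_scope.

(* [inner] is linear in its first argument and antilinear in the second. *)
HB.mixin Record isPreHilbert (R : realType) V & GRing.Lmodule R[i] V :=
  { inner : {dot V for (@Num.conj R[i])} }.

#[short(type="preHilbertType")]
HB.structure Definition PreHilbert (R : realType) :=
  {V of GRing.Lmodule R[i] V & isPreHilbert R V}.

HB.mixin Record isHilbert (R : realType) V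
    & PreHilbert R V & CompleteNormedModule R[i] V :=
  { inner_normE : forall v : V, inner v v = `|v| ^+ 2 }.

#[short(type="hilbertType")]
HB.structure Definition Hilbert (R : realType) :=
  {V of PreHilbert R V & CompleteNormedModule R[i] V & isHilbert R V}.

Section HilbertTheory.
Context {R : realType}.

Lemma conj_inner (M : preHilbertType R) (u v : M) :
  inner v u = (inner u v)^*%C.
Proof. by rewrite (hermC inner) expr0 mul1r. Qed.

(* The norm of a module over [R[i]] is [R[i]]-valued; this is its value in R. *)
Definition rnorm {M : normedModType R[i]} (v : M) : R := complex.Re `|v|.

Lemma rnormE (M : normedModType R[i]) (v : M) : (rnorm v)%:C = `|v|.
Proof. by rewrite /rnorm RRe_real ?normr_real. Qed.

Lemma rnorm_ge0 (M : normedModType R[i]) (v : M) : 0 <= rnorm v.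
Proof. by have := normr_ge0 v; rewrite lecE => /andP[]. Qed.

Lemma rnorm0 (M : normedModType R[i]) : rnorm (0 : M) = 0.
Proof. by rewrite /rnorm normr0. Qed.

Lemma rnorm_eq0 (M : normedModType R[i]) (v : M) : rnorm v = 0 -> v = 0.
Proof. by move=> v0; apply/normr0_eq0; rewrite -rnormE v0. Qed.

Lemma rnormZ (M : normedModType R[i]) (a : R[i]) (v : M) :
  rnorm (a *: v) = complex.Re `|a| * rnorm v.
Proof.
apply/complexI; rewrite rmorphM/= !rnormE normrZ; congr (_ * _).
Qed.

Lemma rnorm_dist (M : normedModType R[i]) (u v : M) :
  `|rnorm u - rnorm v| <= rnorm (u - v).
Proof.
have h (x y : M) : rnorm x <= rnorm y + rnorm (x - y).
  by rewrite -(@lecR R) rmorphD/= !rnormE -{1}(subrK y x) addrC ler_normD.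
rewrite ler_norml lerBlDl h andbT lerNl opprB lerBlDl.
have -> : rnorm (u - v) = rnorm (v - u) by rewrite /rnorm distrC.
exact: h.
Qed.

Lemma innerE (M : hilbertType R) (v : M) : inner v v = (rnorm v ^+ 2)%:C.
Proof. by rewrite inner_normE -rnormE rmorphXn. Qed.

Lemma rnormD_sq (M : hilbertType R) (u v : M) :
  rnorm (u + v) ^+ 2 = rnorm u ^+ 2 + rnorm v ^+ 2 + 2 * complex.Re (inner u v).
Proof.
apply/complexI; rewrite -innerE (hnormD inner)/= expr0 mul1r.
rewrite !rmorphD/= -!innerE; congr (_ + _).
by rewrite rmorphM/= rmorph_nat -addcJ.
Qed.

Lemma rnormB_sq (M : hilbertType R) (u v : M) :
  rnorm (u - v) ^+ 2 = rnorm u ^+ 2 + rnorm v ^+ 2 - 2 * complex.Re (inner u v).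
Proof.
rewrite rnormD_sq; congr (_ + _ ^+ 2 + _); first by rewrite /rnorm normrN.
by rewrite linearNr raddfN/= mulrN.
Qed.

Lemma Im_inner (M : hilbertType R) (u v : M) :
  complex.Im (inner u v) = complex.Re (inner u ('i%C *: v)).
Proof. by rewrite linearZr/=; case: (inner u v) => a b /=; ring. Qed.

End HilbertTheory.

Section StronglyMeasurable.
Context {R : realType}.

Definition is_simple (T : Type) (s : R -> T) :=
  finite_set (range s) /\ forall y, measurable (s @^-1` [set y]).

(* Everywhere (rather than almost everywhere) limits of simple functions; both
   choices give the same classes modulo equality almost everywhere. *)
Definition strongly_measurable (M : normedModType R[i]) (f : R -> M) :=
  exists2 s : nat -> R -> M, forall n, is_simple (s n) &
    forall x, s n x @[n --> \oo] --> f x.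

Lemma simple_preimage (T : Type) (s : R -> T) (A : set T) :
  is_simple s -> measurable (s @^-1` A).
Proof.
move=> [fs ms].
have -> : s @^-1` A = \bigcup_(y in range s `&` A) s @^-1` [set y].
  rewrite eqEsubset; split=> x /=; last by move=> [y [_ Ay] ->].
  by move=> Ax; exists (s x) => //; split=> //; exists x.
apply: fin_bigcup_measurable => [|y _]; last exact: ms.
exact: sub_finite_set (@subIsetl _ _ _) fs.
Qed.

Lemma simple_comp (T U : Type) (h : T -> U) (s : R -> T) :
  is_simple s -> is_simple (h \o s).
Proof.
move=> ss; split; last first.
  by move=> y; rewrite comp_preimage; exact: simple_preimage.
by rewrite -(image_comp s h); apply: finite_image; exact: ss.1.
Qed.

Lemma simple_pair (T U : Type) (s : R -> T) (t : R -> U) :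
  is_simple s -> is_simple t -> is_simple (fun x => (s x, t x)).
Proof.
move=> [fs ms] [ft mt]; split.
  apply: (sub_finite_set _ (finite_setX fs ft)) => _ [x _ <-].
  by split; exists x.
move=> [y z]; have -> : (fun x => (s x, t x)) @^-1` [set (y, z)] =
    s @^-1` [set y] `&` t @^-1` [set z].
  by rewrite eqEsubset; split=> x /= [-> ->].
exact: measurableI.
Qed.

Lemma strongly_measurable_rnorm (M : normedModType R[i]) (f : R -> M) :
  strongly_measurable f ->
  measurable_fun [set: measurableTypeR R] (fun x => rnorm (f x)).
Proof.
move=> [s ss sf].
apply: (measurable_fun_cvg (h := fun n x => rnorm (s n x))) => [n|x _].
  move=> _ B _; rewrite setTI.
  exact: (simple_preimage B (simple_comp rnorm (ss n))).
apply/cvgrPdist_lt => e e0; have := sf x.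
have e0' : 0 < e%:C by rewrite ltcR.
move/cvgrPdist_lt => /(_ _ e0'); apply: filterS => n.
rewrite -rnormE ltcR; apply: le_lt_trans; exact: rnorm_dist.
Qed.

Lemma strongly_measurable_cst (M : normedModType R[i]) (a : M) :
  strongly_measurable (fun=> a).
Proof.
exists (fun _ _ => a) => [n|x]; last exact: cvg_cst.
split; first exact: finite_image_cst.
by move=> y; rewrite preimage_cst; case: ifP.
Qed.

Lemma strongly_measurableD (M : normedModType R[i]) (f g : R -> M) :
  strongly_measurable f -> strongly_measurable g -> strongly_measurable (f \+ g).
Proof.
move=> [s ss sf] [t st tg]; exists (fun n x => s n x + t n x) => [n|x].
  exact: (simple_comp (fun p => p.1 + p.2) (simple_pair (ss n) (st n))).
exact: cvgD.
Qed.

Lemma strongly_measurableZ (M : normedModType R[i]) (a : R[i]) (f : R -> M) :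
  strongly_measurable f -> strongly_measurable (a \*: f).
Proof.
move=> [s ss sf]; exists (fun n x => a *: s n x) => [n|x].
  exact: (simple_comp (fun v => a *: v) (ss n)).
exact: cvgZr.
Qed.

Lemma strongly_measurable_translate (M : normedModType R[i]) (f : R -> M) t :
  strongly_measurable f -> strongly_measurable (fun x => f (x - t)).
Proof.
have mt : measurable_fun setT (fun x : R => x - t) by exact: measurable_funB.
move=> [s ss sf]; exists (fun n x => s n (x - t)) => [n|x]; last exact: sf.
split.
  by apply: sub_finite_set (ss n).1 => _ [x _ <-]; exists (x - t).
by move=> y; have := mt measurableT _ ((ss n).2 y); rewrite setTI.
Qed.

Lemma strongly_measurable_isometry (M N : normedModType R[i]) (V : M -> N)
    (f : R -> M) : (forall u v, `|V u - V v| = `|u - v|) ->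
  strongly_measurable f -> strongly_measurable (V \o f).
Proof.
move=> isoV [s ss sf]; exists (fun n => V \o s n) => [n|x].
  exact: simple_comp.
apply/cvgrPdist_lt => e e0; move/cvgrPdist_lt : (sf x) => /(_ _ e0).
by apply: filterS => n; rewrite isoV.
Qed.

End StronglyMeasurable.

#[global] Instance ae_lebesgue_filter (R : realType) :
  Filter (almost_everywhere (@lebesgue_measure R)) :=
  ae_filter_ringOfSetsType lebesgue_measure.

Section LebesgueTranslation.
Context {R : realType}.
Local Notation mu := (@lebesgue_measure R).

Lemma measurable_translate (t : R) :
  measurable_fun [set: measurableTypeR R] (fun x : R => (x - t : measurableTypeR R)).
Proof. exact: measurable_funB. Qed.

Lemma lebesgue_measure_translate (t : R) (A : set R) : measurable A ->
  pushforward mu (fun x : R => (x - t : measurableTypeR R)) A = mu A.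
Proof.
move=> mA; apply/esym/lebesgue_measure_unique => //=.
  exact: measurable_translate.
move=> mt _ [[a b]] _ <-; rewrite /pushforward/=.
have -> : (fun x : R => x - t) @^-1` `]a, b] = `]a + t, b + t]%classic.
  by apply/seteqP; split=> x; rewrite /= !in_itv/= ltrBrDr lerBlDr.
rewrite !lebesgue_measure_itv/= !lte_fin ltrD2r; case: ifP => // _.
by rewrite -!EFinB; congr EFin; ring.
Qed.

Lemma ae_translate (t : R) (P : R -> Prop) :
  {ae mu, forall x, P x} -> {ae mu, forall x, P (x - t)}.
Proof.
move=> [N [mN N0 PN]]; exists ((fun x : R => x - t) @^-1` N); split.
- by rewrite -[X in measurable X]setTI; apply: measurable_translate.
- by rewrite -N0; exact: lebesgue_measure_translate.
- by move=> x /= /PN.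
Qed.

Lemma integrable_translate (t : R) (f : R -> \bar R) :
  mu.-integrable setT f -> mu.-integrable setT (fun x => f (x - t)).
Proof.
move=> /integrableP[mf foo]; apply/integrableP; split.
  exact: (measurableT_comp mf (measurable_translate t)).
have mt := measurable_translate t.
have := ge0_integral_pushforward mt mu (f := fun x => `|f x|%E) measurableT.
rewrite preimage_setT => <- //; first last.
  exact: measurableT_comp.
rewrite (eq_measure_integral mu) // => A mA _.
exact: lebesgue_measure_translate.
Qed.

End LebesgueTranslation.

Section L2.
Context {R : realType} (M : hilbertType R).
Local Notation mu := (@lebesgue_measure R).
Implicit Types f g h : R -> M.

Definition L2_pred : {pred R -> M} := fun f => `[< strongly_measurable f /\
  mu.-integrable setT (fun x => (rnorm (f x) ^+ 2)%:E) >].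

Lemma L2_predP f : reflect (strongly_measurable f /\
  mu.-integrable setT (fun x => (rnorm (f x) ^+ 2)%:E)) (f \in L2_pred).
Proof. exact: asboolP. Qed.

Lemma L2_submod_closed : submod_closed L2_pred.
Proof.
split.
  apply/L2_predP; split; first exact: strongly_measurable_cst.
  apply: eq_integrable (integrable0 _ _) => // x _ /=.
  by rewrite rnorm0 expr0n.
move=> a f g /L2_predP[mf If] /L2_predP[mg Ig]; apply/L2_predP; split.
  by apply: strongly_measurableD => //; exact: strongly_measurableZ.
have mn := strongly_measurable_rnorm
  (strongly_measurableD (strongly_measurableZ a mf) mg).
pose c := complex.Re `|a| ^+ 2 *+ 2.
have Ib : mu.-integrable setT
    (fun x => (c * rnorm (f x) ^+ 2 + 2 * rnorm (g x) ^+ 2)%:E).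
  exact: (integrableD measurableT (integrableZl measurableT c If)
                                  (integrableZl measurableT 2 Ig)).
apply: le_integrable Ib => //.
  by apply/measurable_EFinP; exact: measurable_funX.
move=> x _; rewrite !abse_EFin lee_fin.
rewrite ger0_norm ?sqr_ge0// (le_trans _ (ler_norm _))//.
have := rnormD_sq (a *: f x) (g x); have := rnormB_sq (a *: f x) (g x).
have := sqr_ge0 (rnorm (a *: f x - g x)).
rewrite rnormZ exprMn /c -mulr_natl.
change ((a \*: f \+ g) x) with (a *: f x + g x); lra.
Qed.

HB.instance Definition _ := GRing.isSubmodClosed.Build _ _ L2_pred
  L2_submod_closed.

Record L2fun := MkL2fun { L2val :> R -> M; L2valP : L2val \in L2_pred }.

HB.instance Definition _ := [isSub for L2val].
HB.instance Definition _ := [Choice of L2fun by <:].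
HB.instance Definition _ := [SubChoice_isSubLmodule of L2fun by <:].

Lemma L2funPE a (f g : L2fun) x : (a *: f + g) x = a *: f x + g x.
Proof. by []. Qed.

Lemma L2funBE (f g : L2fun) x : (f - g) x = f x - g x.
Proof. by []. Qed.

Definition null_pred : {pred L2fun} :=
  fun f : L2fun => `[< {ae mu, forall x, f x = 0} >].

Lemma null_predP (f : L2fun) :
  reflect {ae mu, forall x, f x = 0} (f \in null_pred).
Proof. exact: asboolP. Qed.

Lemma null_submod_closed : submod_closed null_pred.
Proof.
split; first by apply/null_predP; exact: aeW.
move=> a /= f g /null_predP f0 /null_predP g0; apply/null_predP.
move: f0 g0; apply: filterS2 => x; rewrite L2funPE => -> ->.
by rewrite scaler0 addr0.
Qed.

HB.instance Definition _ := GRing.isSubmodClosed.Build _ _ null_pred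
  null_submod_closed.

(* Square integrable functions modulo almost everywhere equality; the coercion
   [L2repr] below picks a representative.  Only the inner product space structure
   is set up here: completeness is not needed to speak of a unitary map from a
   Hilbert space onto [L2 M]. *)
Definition L2 : Type := Quotient.quot null_pred.
HB.instance Definition _ := GRing.Zmodule.on L2.
HB.instance Definition _ := EqQuotient.on L2.

Definition L2repr (F : L2) : L2fun := repr F.
Coercion L2repr : L2 >-> L2fun.


Local Open Scope quotient_scope.

Lemma L2_eqP (f g : L2fun) :
  \pi_L2 f = \pi_L2 g <-> {ae mu, forall x, f x = g x}.
Proof.
have -> : (\pi_L2 f = \pi_L2 g) <-> f - g \in null_pred.
  by rewrite Quotient.idealrBE; split => /eqP.
split=> [/null_predP|fg]; first by apply: filterS => x; rewrite L2funBE => /subr0_eq.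
apply/null_predP; move: fg; apply: filterS => x.
by rewrite L2funBE => ->; rewrite subrr.
Qed.

Lemma L2_repr_pi (f : L2fun) : {ae mu, forall x, (\pi_L2 f : L2) x = f x}.
Proof. by apply/L2_eqP; rewrite reprK. Qed.

Lemma L2_extP (F G : L2) : F = G <-> {ae mu, forall x, F x = G x}.
Proof. by rewrite -L2_eqP !reprK. Qed.

Definition L2scale (a : R[i]) (F : L2) : L2 := \pi_L2 (a *: (F : L2fun)).

Lemma L2_piD (f g : L2fun) : \pi_L2 (f + g) = \pi_L2 f + \pi_L2 g.
Proof. exact: Quotient.pi_add. Qed.

Lemma L2scale_pi a (f : L2fun) : L2scale a (\pi_L2 f) = \pi_L2 (a *: f).
Proof.
apply/L2_eqP; have := L2_repr_pi f; apply: filterS => x fx.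
by rewrite -[a *: _]addr0 -[a *: f]addr0 !L2funPE fx.
Qed.

Fact L2scaleA a b F : L2scale a (L2scale b F) = L2scale (a * b) F.
Proof. by rewrite -[F]reprK (L2scale_pi b) !L2scale_pi scalerA. Qed.

Fact L2scale1r : left_id 1 L2scale.
Proof. by move=> F; rewrite -[F]reprK !L2scale_pi scale1r. Qed.

Fact L2scaleDr : right_distributive L2scale +%R.
Proof.
by move=> a F G; rewrite -[F]reprK -[G]reprK -L2_piD !L2scale_pi -L2_piD scalerDr.
Qed.

Fact L2scaleDl F : {morph L2scale^~ F : a b / a + b}.
Proof. by move=> a b; rewrite -[F]reprK !L2scale_pi -L2_piD scalerDl. Qed.

HB.instance Definition _ := GRing.Zmodule_isLmodule.Build R[i] L2
  L2scaleA L2scale1r L2scaleDr L2scaleDl.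

Lemma L2_piP a (f g : L2fun) :
  \pi_L2 (a *: f + g) = a *: \pi_L2 f + \pi_L2 g.
Proof. by rewrite L2_piD -L2scale_pi. Qed.

Lemma L2PE a (F G : L2) :
  {ae mu, forall x, (a *: F + G : L2) x = a *: F x + G x}.
Proof.
by have := L2_repr_pi (a *: (F : L2fun) + G); rewrite L2_piP !reprK.
Qed.

Definition L2dot f g : R[i] :=
  (\int[mu]_x complex.Re (inner (f x) (g x))) +i*
  (\int[mu]_x complex.Im (inner (f x) (g x))).

Lemma integrable_Re_inner f g : f \in L2_pred -> g \in L2_pred ->
  mu.-integrable setT (fun x => (complex.Re (inner (f x) (g x)))%:E).
Proof.
move=> fL gL; have /L2_predP[_ I1] : f + g \in L2_pred by rewrite rpredD.
have /L2_predP[_ I2] : f - g \in L2_pred by rewrite rpredB.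
have := integrableZl measurableT (4^-1) (integrableB measurableT I1 I2).
apply: eq_integrable => // x _.
have -> : complex.Re (inner (f x) (g x)) =
    4^-1 * (rnorm (f x + g x) ^+ 2 - rnorm (f x - g x) ^+ 2).
  by rewrite rnormD_sq rnormB_sq; field.
by [].
Qed.

Lemma integrable_Im_inner f g : f \in L2_pred -> g \in L2_pred ->
  mu.-integrable setT (fun x => (complex.Im (inner (f x) (g x)))%:E).
Proof.
move=> fL gL; have igL : 'i%C *: g \in L2_pred by rewrite rpredZ.
have := integrable_Re_inner fL igL; apply: eq_integrable => // x _.
by rewrite Im_inner.
Qed.

Lemma L2dotC f g : f \in L2_pred -> g \in L2_pred ->
  L2dot g f = (L2dot f g)^*%C.
Proof.
move=> fL gL; rewrite /L2dot/=; congr (_ +i* _).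
  by apply: eq_Rintegral => x _; rewrite conj_inner; case: (inner _ _).
rewrite -mulN1r -RintegralZl//; last exact: integrable_Im_inner.
by apply: eq_Rintegral => x _; rewrite conj_inner mulN1r; case: (inner _ _).
Qed.

Lemma L2dotP a f g h : f \in L2_pred -> g \in L2_pred -> h \in L2_pred ->
  L2dot (a *: f + g) h = a * L2dot f h + L2dot g h.
Proof.
move=> fL gL hL.
have [Rf If] := (integrable_Re_inner fL hL, integrable_Im_inner fL hL).
have [Rg Ig] := (integrable_Re_inner gL hL, integrable_Im_inner gL hL).
have lin (c d : R) (u v w : R -> R) :
    mu.-integrable setT (EFin \o u) -> mu.-integrable setT (EFin \o v) ->
    mu.-integrable setT (EFin \o w) ->
    \int[mu]_x (c * u x + d * v x + w x) =
    c * (\int[mu]_x u x) + d * (\int[mu]_x v x) + \int[mu]_x w x.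
  move=> Iu Iv Iw.
  have Icu := integrableZl measurableT c Iu.
  have Idv := integrableZl measurableT d Iv.
  rewrite RintegralD//; last exact: (integrableD measurableT Icu Idv).
  by rewrite RintegralD// !RintegralZl.
rewrite /L2dot; case: a => p q; rewrite /GRing.mul /GRing.add /=.
congr (_ +i* _).
- rewrite -[_ - q * _]/(_ + - (q * _)) -mulNr -lin//.
  apply: eq_Rintegral => x _.
  by rewrite linearPl/=; case: (inner _ _) => ? ?; case: (inner _ _) => ? ? /=; ring.
- rewrite -lin//.
  apply: eq_Rintegral => x _.
  by rewrite linearPl/=; case: (inner _ _) => ? ?; case: (inner _ _) => ? ? /=; ring.
Qed.

Lemma L2dotE f : L2dot f f = (\int[mu]_x (rnorm (f x) ^+ 2))%:C.
Proof.
rewrite /L2dot; congr (_ +i* _).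
  by apply: eq_Rintegral => x _; rewrite innerE.
rewrite (@eq_Rintegral _ _ _ _ _ (cst 0)) => [|x _]; last by rewrite innerE.
by rewrite Rintegral_cst// mul0r.
Qed.

Lemma L2dot_ge0 f : 0 <= L2dot f f.
Proof.
rewrite L2dotE -[0]/(0%:C) lecR; apply: Rintegral_ge0 => x _; exact: sqr_ge0.
Qed.

Lemma L2dot_eq0 f : f \in L2_pred -> L2dot f f = 0 ->
  {ae mu, forall x, f x = 0}.
Proof.
move=> /L2_predP[_ If]; rewrite L2dotE => /(congr1 (@complex.Re _))/= f0.
have mf := measurable_int _ If.
have /(ae_eq_integral_abs mu measurableT mf) :
    (\int[mu]_x `|(rnorm (f x) ^+ 2)%:E|)%E = 0%E.
  under eq_integral do rewrite gee0_abs ?lee_fin ?sqr_ge0//.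
  by rewrite -(fineK (integrable_fin_num measurableT If)) [fine _]f0.
apply: filterS => x /(_ I) [] /eqP; rewrite sqrf_eq0 => /eqP.
exact: rnorm_eq0.
Qed.

Lemma L2dot_ae f g h : f \in L2_pred -> g \in L2_pred -> h \in L2_pred ->
  {ae mu, forall x, f x = g x} -> L2dot f h = L2dot g h.
Proof.
move=> fL gL hL fg.
have [Rf If] := (integrable_Re_inner fL hL, integrable_Im_inner fL hL).
have [Rg Ig] := (integrable_Re_inner gL hL, integrable_Im_inner gL hL).
rewrite /L2dot /Rintegral; congr (fine _ +i* fine _); apply: ae_eq_integral => //.
- exact: measurable_int Rf.
- exact: measurable_int Rg.
- by move: fg; apply: filterS => x fgx _; rewrite fgx.
- exact: measurable_int If.
- exact: measurable_int Ig.
- by move: fg; apply: filterS => x fgx _; rewrite fgx.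
Qed.

Definition L2inner (F G : L2) : R[i] := L2dot F G.

Fact L2innerC F G : L2inner F G = (-1) ^+ false * (L2inner G F)^*.
Proof. by rewrite mul1r; exact: (L2dotC (L2valP G) (L2valP F)). Qed.

Fact L2innerP G : scalar (L2inner^~ G).
Proof.
move=> a F F'; rewrite -L2dotP ?L2valP//; apply: L2dot_ae; rewrite ?L2valP//.
  by rewrite rpredD ?rpredZ ?L2valP.
exact: L2PE.
Qed.

Fact L2inner_bilinear : bilinear_for *%R (Num.conj \; *%R) L2inner.
Proof.
split=> [G|F]; first exact: L2innerP.
move=> a G G'; rewrite L2innerC mul1r L2innerP rmorphD rmorphM/=.
by rewrite (L2innerC F G) (L2innerC F G') !mul1r.
Qed.

Fact L2inner_gt0 F : F != 0 -> 0 < L2inner F F.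
Proof.
move=> F0; rewrite lt_neqAle L2dot_ge0 andbT; apply: contra F0 => /eqP/esym FF0.
have pi0 : \pi_L2 0 = 0 by apply: (addrI (\pi_L2 0)); rewrite -L2_piD !addr0.
apply/eqP/L2_extP; have := L2dot_eq0 (L2valP _) FF0.
have := L2_repr_pi (0 : L2fun); rewrite pi0; apply: filterS2 => x -> ->.
by [].
Qed.

HB.instance Definition _ := bilinear_isBilinear.Build R[i] L2 L2 R[i] _ _
  L2inner L2inner_bilinear.
HB.instance Definition _ := isHermitianSesquilinear.Build R[i] L2 false Num.conj
  L2inner L2innerC.
HB.instance Definition _ := isDotProduct.Build R[i] L2 L2inner L2inner_gt0.
HB.instance Definition _ := isPreHilbert.Build R L2 L2inner.
End L2.

Section L2Operators.
Context {R : realType}.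
Local Notation mu := (@lebesgue_measure R).
Local Open Scope quotient_scope.

(* The class of f, and the junk value 0 when f is not square integrable. *)
Definition L2class (M : hilbertType R) (f : R -> M) : L2 M :=
  \pi_(L2 M) (insubd 0 f : L2fun M).

Lemma L2classE (M : hilbertType R) (f : R -> M) : f \in @L2_pred R M ->
  {ae mu, forall x, L2class f x = f x}.
Proof.
by move=> fL; have := L2_repr_pi (insubd 0 f : L2fun M); rewrite insubdK.
Qed.

Definition L2translate (M : hilbertType R) (t : R) (F : L2 M) : L2 M :=
  L2class (fun x => F (x - t)).

Lemma L2_pred_translate (M : hilbertType R) (t : R) (f : R -> M) :
  f \in @L2_pred R M -> (fun x => f (x - t)) \in @L2_pred R M.
Proof.
move=> /L2_predP[mf If]; apply/L2_predP; split.
  exact: strongly_measurable_translate.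
exact: (integrable_translate t If).
Qed.

Lemma L2translateE (M : hilbertType R) (t : R) (F : L2 M) :
  {ae mu, forall x, L2translate t F x = F (x - t)}.
Proof. by apply: L2classE; apply: L2_pred_translate; exact: L2valP. Qed.

Lemma L2translate_class (M : hilbertType R) (t : R) (f : R -> M) :
  f \in @L2_pred R M -> L2translate t (L2class f) = L2class (fun x => f (x - t)).
Proof.
move=> fL; apply/L2_extP; have := L2translateE t (L2class f).
have := L2classE (L2_pred_translate t fL).
have := ae_translate t (L2classE fL).
by apply: filterS3 => x -> -> ->.
Qed.

(* L^2([0, +oo[, M) as a subspace of L^2(R, M). *)
Definition L2half (M : hilbertType R) : set (L2 M) :=
  [set F | {ae mu, forall x, x < 0 -> F x = 0}].

Definition unitary (E F : preHilbertType R) (V : E -> F) :=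
  [/\ linear V, isometry inner inner V & range V = setT].

(* The operator id (x) V under the identification L^2(R, M) = L^2(R) (x) M *)
Definition L2map (M N : hilbertType R) (V : M -> N) (F : L2 M) : L2 N :=
  L2class (V \o F).

Lemma unitary_rnorm (M N : hilbertType R) (V : M -> N) (v : M) :
  unitary V -> rnorm (V v) = rnorm v.
Proof.
move=> [_ isoV _]; apply/eqP; rewrite -(@eqrXn2 _ 2) ?rnorm_ge0//; apply/eqP.
by apply/complexI; rewrite -!innerE isoV.
Qed.

Lemma L2_pred_map (M N : hilbertType R) (V : M -> N) (f : R -> M) :
  unitary V -> f \in @L2_pred R M -> V \o f \in @L2_pred R N.
Proof.
move=> uV; have [linV isoV _] := uV.
move=> /L2_predP[mf If]; apply/L2_predP; split.
  apply: strongly_measurable_isometry mf => u v.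
  have -> : V u - V v = V (u - v).
    by rewrite -scaleN1r addrC -linV scaleN1r addrC.
  by rewrite -!rnormE unitary_rnorm.
by apply: eq_integrable If => // x _ /=; rewrite unitary_rnorm.
Qed.

Lemma L2mapE (M N : hilbertType R) (V : M -> N) (F : L2 M) : unitary V ->
  {ae mu, forall x, L2map V F x = V (F x)}.
Proof. by move=> uV; apply/L2classE/L2_pred_map => //; exact: L2valP. Qed.

Lemma L2map_class (M N : hilbertType R) (V : M -> N) (f : R -> M) :
  unitary V -> f \in @L2_pred R M -> L2map V (L2class f) = L2class (V \o f).
Proof.
move=> uV fL; apply/L2_extP; have := L2mapE (L2class f) uV.
have := L2classE (L2_pred_map uV fL); have := L2classE fL.
by apply: filterS3 => x -> -> ->.
Qed.

End L2Operators.
Arguments L2half : clear implicits.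

Section ReflectionPositivity.
Context {R : realType} {E : hilbertType R}.
Implicit Types (Ep : set E) (theta : E -> E) (U : R -> E -> E).

Definition subspace (A : set E) := submod_closed [in A].

Definition linear_span (A : set E) : set E := smallest subspace A.

Definition reflection_positive_space Ep theta :=
  [/\ unitary theta, involutive theta, subspace Ep, closed Ep &
      forall v, Ep v -> 0 <= inner (theta v) v].

Definition unitary_one_parameter_group U :=
  [/\ forall t, unitary (U t), forall v, U 0 v = v,
      forall s t v, U (s + t) v = U s (U t v) &
      forall v, continuous (U^~ v)].

Definition reflection_positive_group Ep theta U :=
  [/\ unitary_one_parameter_group U,
      forall t, 0 < t -> U t @` Ep `<=` Ep &
      forall t v, theta (U t (theta v)) = U (- t) v].

Definition cyclic_subspace U Ep :=
  dense (linear_span (\bigcup_t (U t @` Ep))).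

Definition fixed_vectors U : set E := [set v | forall t, U t v = v].

Definition outgoing U Ep :=
  [/\ subspace Ep /\ closed Ep,
      forall t, 0 < t -> U t @` Ep `<=` Ep,
      \bigcap_(t in [set t : R | 0 < t]) (U t @` Ep) = [set 0] &
      dense (\bigcup_(t in [set t : R | t < 0]) (U t @` Ep))].

Definition outgoing_realization U Ep (M : hilbertType R) (Phi : E -> L2 M) :=
  [/\ unitary Phi, Phi @` Ep = L2half R M &
      forall t v, Phi (U t v) = L2translate t (Phi v)].

End ReflectionPositivity.

(* Main.v *)
Require Import Defs.
From HB Require Import structures.
From mathcomp Require Import all_boot all_order all_algebra.
From mathcomp Require Import complex.
From mathcomp Require Import all_classical all_reals all_analysis.
From mathcomp Require Import measurable_realfun ring lra zify.
Set Implicit Arguments.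
Unset Strict Implicit.
Unset Printing Implicit Defensive.
Import Order.TTheory GRing.Theory Num.Theory.
Import numFieldNormedType.Exports.
Local Open Scope classical_set_scope.
Local Open Scope ring_scope.

(** The subspace Ep is outgoing for two separate reasons. Translates of Ep
    decrease in time, so the union of the past translates is already a
    subspace and cyclicity makes it dense. For the remote future, take v with
    all its translates in Ep: reflection positivity of the differences of
    translates says that t |-> <theta v, U_t v> has nonnegative second
    differences, and it is bounded, hence constant ([bounded_convex_cst]). So
    U_t v - v is null for the positive form <theta x, y>, which forces theta
    (U_t v - v) to be orthogonal to every translate of Ep; by cyclicity v is
    fixed, hence 0 ([invariant_fixed]).

    The representation on L^2(R, M) is built around the functions e_t(x) =
    e^{-(x - t)/2} for x >= t, 0 for x < t, tensored with vectors m. For a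
    vector of L^2([0, oo[, M), being of the form e_0 (x) m means being
    orthogonal, after subtraction of e^{-t/2} times its translate, to
    everything that lives after t. This condition makes sense in Ep: it reads
    <m, U_t z> = e^{-t/2} <m, z> for t >= 0 and z in Ep, and it cuts out a
    closed subspace [expspace], which is taken as the multiplicity space M.
    For free, <U_s m, U_t m'> = e^{-|t - s|/2} <m, m'>, and the e_t (x) m have
    the same Gram matrix, so U_t m |-> e_t (x) m extends to a unitary map once
    both families are known to be total.

    Totality in E ([expspace_total]) is the heart of the matter: a priori M
    could be 0. Cut time into intervals of length h and each interval into 2^k
    cells. The vectors that repeat on all cells, damped by e^{-t/2}, form
    closed subspaces that decrease with k, and a vector common to all of them
    is m - e^{-h/2} U_h m for some m in M ([dyadic_qper_expspace]). If w is
    orthogonal to the orbit of M, then its projections onto these subspaces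
    tend to 0 ([proj_nested_cvg0]). But averaging w over the cells gives a
    vector of the k-th subspace whose distance to w is at most the modulus of
    continuity of t |-> e^{-t/2} U_t w at scale h, uniformly in k
    ([qper_approx]). So |w|^2 is at most twice the square of that modulus,
    which tends to 0 with h.

    Totality in L^2(R, M) ([L2_total]) is Lebesgue's differentiation theorem
    applied to x |-> e^{-x/2} <F(x), m>, followed by the observation that a
    strongly measurable function takes its values in the closure of a
    countable set. Existence of the function attached to a vector of E is a
    Riesz-Fischer argument along a fast sequence of combinations of the U_t m
    ([riesz_fischer]).

    For uniqueness, any outgoing realization identifies [expspace] with the
    vectors e_0 (x) m ([realization_expspace], [expspace_realization]);
    comparing two realizations on [expspace] gives V, and totality does the
    rest. *)

(** * The real inner product *)

Section RealDot.
Context {R : realType} {H : preHilbertType R}.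
Implicit Types (u v w : H) (a b : R).

(** Only the real part of the inner product is used: for complex subspaces and
    complex-linear maps, real orthogonality and real isometry already imply
    the complex notions, and estimates take place in R. *)
Definition dot u v : R := complex.Re (inner u v).
Definition sqn u : R := dot u u.
Definition rscale a u : H := (a%:C)%C *: u.

Lemma dotC u v : dot u v = dot v u.
Proof. by rewrite /dot (conj_inner u v); case: (inner u v). Qed.

Lemma dotDl u v w : dot (u + v) w = dot u w + dot v w.
Proof. by rewrite /dot linearDl raddfD. Qed.

Lemma dotNl u w : dot (- u) w = - dot u w.
Proof. by rewrite /dot linearNl raddfN. Qed.

Lemma dotBl u v w : dot (u - v) w = dot u w - dot v w.
Proof. by rewrite dotDl dotNl. Qed.

Lemma dotZl a u w : dot (rscale a u) w = a * dot u w.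
Proof.
rewrite /dot /rscale linearZl_LR /=; case: (inner u w) => x y /=.
by rewrite mul0r subr0.
Qed.

Lemma dot0l w : dot 0 w = 0.
Proof. by rewrite /dot linear0l. Qed.

Lemma dotDr u v w : dot w (u + v) = dot w u + dot w v.
Proof. by rewrite dotC dotDl !(dotC w). Qed.
Lemma dotNr u w : dot w (- u) = - dot w u.
Proof. by rewrite dotC dotNl dotC. Qed.
Lemma dotBr u v w : dot w (u - v) = dot w u - dot w v.
Proof. by rewrite dotDr dotNr. Qed.
Lemma dotZr a u w : dot w (rscale a u) = a * dot w u.
Proof. by rewrite dotC dotZl dotC. Qed.
Lemma dot0r w : dot w 0 = 0.
Proof. by rewrite dotC dot0l. Qed.

Definition dotE := (dotDl, dotDr, dotNl, dotNr, dotZl, dotZr, dot0l, dot0r).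

Lemma dot_suml (I : Type) (r : seq I) (P : pred I) (F : I -> H) w :
  dot (\sum_(i <- r | P i) F i) w = \sum_(i <- r | P i) dot (F i) w.
Proof. by apply: (big_morph (dot^~ w)) => [u v|]; rewrite ?dotDl ?dot0l. Qed.

Lemma dot_sumr (I : Type) (r : seq I) (P : pred I) (F : I -> H) w :
  dot w (\sum_(i <- r | P i) F i) = \sum_(i <- r | P i) dot w (F i).
Proof. by rewrite dotC dot_suml; apply: eq_bigr => i _; rewrite dotC. Qed.

Lemma Im_dot u v : complex.Im (inner u v) = dot u ('i%C *: v).
Proof. by rewrite /dot linearZr/=; case: (inner u v) => a b /=; ring. Qed.

(** The adjoint of a complex scalar; this is what turns real orthogonality to
    a complex subspace into a complex-linear condition. *)
Lemma dotZcl (c : R[i]) u v : dot (c *: u) v = dot u ((c^*)%C *: v).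
Proof.
rewrite /dot linearZl_LR linearZr/=; case: c => x y.
by case: (inner u v) => z t /=; ring.
Qed.

Lemma inner_sqn u : inner u u = ((sqn u)%:C)%C.
Proof.
rewrite /sqn /dot; apply/esym/RRe_real; rewrite CrealE; apply/eqP.
by rewrite [RHS](conj_inner u u).
Qed.

Lemma sqn_ge0 u : 0 <= sqn u.
Proof.
have [->|u0] := eqVneq u 0; first by rewrite /sqn dot0l.
have := dnorm_gt0 (inner) u; rewrite u0 inner_sqn.
by rewrite (@ltcR R 0) => /ltW.
Qed.

Lemma sqn_eq0 u : sqn u = 0 -> u = 0.
Proof.
move=> u0; apply/eqP; apply: contraTT isT => nu.
by have := dnorm_gt0 (inner) u; rewrite nu inner_sqn u0 ltxx.
Qed.

Lemma dot_ext u v : (forall w, dot u w = dot v w) -> u = v.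
Proof.
move=> uv; apply/subr0_eq/sqn_eq0.
by rewrite /sqn dotBl uv subrr.
Qed.

Lemma rscaleE a u : rscale a u = (a%:C)%C *: u. Proof. by []. Qed.
Lemma rscaleDl a b u : rscale (a + b) u = rscale a u + rscale b u.
Proof. by rewrite /rscale rmorphD scalerDl. Qed.
Lemma rscaleDr a u v : rscale a (u + v) = rscale a u + rscale a v.
Proof. exact: scalerDr. Qed.
Lemma rscaleNr a u : rscale a (- u) = - rscale a u.
Proof. exact: scalerN. Qed.
Lemma rscaleBr a u v : rscale a (u - v) = rscale a u - rscale a v.
Proof. exact: scalerBr. Qed.
Lemma rscaleA a b u : rscale a (rscale b u) = rscale (a * b) u.
Proof. by rewrite /rscale scalerA rmorphM. Qed.
Lemma rscale1 u : rscale 1 u = u.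
Proof. exact: scale1r. Qed.
Lemma rscale0 a : rscale a 0 = 0.
Proof. exact: scaler0. Qed.

Lemma sqnD u v : sqn (u + v) = sqn u + sqn v + 2 * dot u v.
Proof. by rewrite /sqn !dotE (dotC v u); ring. Qed.
Lemma sqnB u v : sqn (u - v) = sqn u + sqn v - 2 * dot u v.
Proof. by rewrite /sqn !dotE (dotC v u); ring. Qed.
Lemma sqnN u : sqn (- u) = sqn u.
Proof. by rewrite /sqn !dotE opprK. Qed.
Lemma sqnZ a u : sqn (rscale a u) = a ^+ 2 * sqn u.
Proof. by rewrite /sqn !dotE; ring. Qed.
Lemma sqn0 : sqn 0 = 0. Proof. exact: dot0l. Qed.
Lemma sqn_distC u v : sqn (u - v) = sqn (v - u).
Proof. by rewrite -sqnN opprB. Qed.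

Lemma dot_sq_le u v : dot u v ^+ 2 <= sqn u * sqn v.
Proof.
have [v0|v0] := eqVneq (sqn v) 0.
  by rewrite (sqn_eq0 v0) dot0r sqn0 expr0n mulr0.
have vp : 0 < sqn v by rewrite lt_neqAle eq_sym v0 sqn_ge0.
have := sqn_ge0 (u - rscale (dot u v / sqn v) v).
rewrite sqnB sqnZ dotZr -(pmulr_lge0 _ vp).
have -> : (sqn u + (dot u v / sqn v) ^+ 2 * sqn v -
  2 * (dot u v / sqn v * dot u v)) * sqn v = sqn u * sqn v - dot u v ^+ 2.
  by field.
by rewrite subr_ge0.
Qed.

(** This replaces the triangle inequality, so that no square roots appear. *)
Lemma sqnD_le u v : sqn (u + v) <= 2 * sqn u + 2 * sqn v.
Proof. by have := sqn_ge0 (u - v); rewrite sqnB sqnD; lra. Qed.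

Lemma sqn_sum_le n (F : nat -> H) :
  sqn (\sum_(i < n) F i) <= n%:R * \sum_(i < n) sqn (F i).
Proof.
elim: n => [|n IH]; first by rewrite !big_ord0 sqn0 mul0r.
rewrite !big_ord_recr /= sqnD; set S := \sum_(i < n) F i in IH *.
suff : 2 * dot S (F n) <= \sum_(i < n) sqn (F i) + n%:R * sqn (F n).
  by move: IH; rewrite -natr1; set a := \sum_(i < n) _; lra.
have -> : n%:R * sqn (F n) = \sum_(i < n) sqn (F n).
  by rewrite sumr_const card_ord mulr_natl.
rewrite /S dot_suml mulr_sumr -big_split /=; apply: ler_sum => i _.
by have := sqn_ge0 (F i - F n); rewrite sqnB; lra.
Qed.

Lemma sqn_sum_orth n (F : nat -> H) :
  (forall i j, (i < j)%N -> dot (F i) (F j) = 0) ->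
  sqn (\sum_(i < n) F i) = \sum_(i < n) sqn (F i).
Proof.
move=> o; elim: n => [|n IH]; first by rewrite !big_ord0 sqn0.
rewrite !big_ord_recr /= sqnD IH dot_suml [X in 2 * X]big1 ?mulr0 ?addr0// =>
  i _.
by rewrite o.
Qed.

End RealDot.

Section SubspaceLemmas.
Context {R : realType} {H : preHilbertType R} (A : set H).
Context (sA : submod_closed [in A]).

Lemma memsub0 : A 0. Proof. by apply/set_mem; exact: sA.1. Qed.
Lemma memsubZD c u v : A u -> A v -> A (c *: u + v).
Proof. by move=> Au Av; apply/set_mem; apply: (sA.2); apply/mem_set. Qed.
Lemma memsubD u v : A u -> A v -> A (u + v).
Proof. by move=> Au Av; rewrite -[u]scale1r; exact: memsubZD. Qed.
Lemma memsubZ c u : A u -> A (c *: u).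
Proof.
by move=> Au; rewrite -[_ *: _]addr0; apply: memsubZD => //; exact: memsub0.
Qed.
Lemma memsubN u : A u -> A (- u).
Proof. by move=> Au; rewrite -scaleN1r; exact: memsubZ. Qed.
Lemma memsubB u v : A u -> A v -> A (u - v).
Proof. by move=> Au Av; apply: memsubD => //; exact: memsubN. Qed.
Lemma memsub_sum n (F : nat -> H) : (forall i, A (F i)) -> A (\sum_(i < n) F i).
Proof.
move=> AF; elim: n => [|n IH]; first by rewrite big_ord0; exact: memsub0.
by rewrite big_ord_recr; apply: memsubD.
Qed.

(** A minimizing sequence for the distance of x to A. The limit may not exist
    in H, hence the explicit rates: the parallelogram law makes the sequence
    Cauchy, and minimality makes x - d n almost orthogonal to A. *)
Lemma approx_proj x : exists d : nat -> H,
  [/\ forall n, A (d n),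
      forall n m, (n <= m)%N -> sqn (d n - d m) <= 4 * n.+1%:R^-1 &
      forall n y, A y -> dot (x - d n) y ^+ 2 <= n.+1%:R^-1 * sqn y].
Proof.
pose Q := [set sqn (x - y) | y in A].
have Q0 : Q !=set0 by exists (sqn (x - 0)); exists 0 => //; exact: memsub0.
have lQ : has_lbound Q by exists 0 => _ [y _ <-]; exact: sqn_ge0.
have Qi y : A y -> inf Q <= sqn (x - y) by move=> Ay; apply: ge_inf => //;
  exists y.
have /choice[d dP] : forall n : nat, exists y, A y /\ sqn (x - y) <
  inf Q + n.+1%:R^-1.
  move=> n; have e0 : 0 < n.+1%:R^-1 :> R by rewrite invr_gt0.
  have [_ [y Ay <-] h] := inf_adherent e0 (conj Q0 lQ).
  by exists y.
exists d; split=> [n|n m nm|n y Ay]; first by have [] := dP n.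
- have [An hn] := dP n; have [Am hm] := dP m.
  have hm' : (m.+1%:R^-1 : R) <= n.+1%:R^-1.
    by rewrite lef_pV2 ?posrE ?ltr0n// ler_nat.
  rewrite (_ : d n - d m = (x - d m) - (x - d n)); last first.
    by rewrite opprB [RHS]addrC addrA subrK.
  have := Qi _ (memsubZ ((2^-1)%:C)%C (memsubD An Am)).
  have -> : x - ((2^-1)%:C)%C *: (d n + d m) =
     rscale 2^-1 ((x - d n) + (x - d m)).
    rewrite -rscaleE !rscaleDr !rscaleNr addrACA -rscaleDl -opprD.
    by congr (_ - _); rewrite -[X in X = _]rscale1; congr rscale; field.
  rewrite sqnZ (sqnB (x - d m)) (sqnD (x - d n)) (dotC (x - d m)).
  move: hn hm hm'; move: (n.+1%:R^-1) (m.+1%:R^-1) => a b.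
  move: (inf Q) (sqn (x - d n)) (sqn _) (dot _ _) => i p q r; rewrite exprVn;
    lra.
- have [An hn] := dP n.
  have h a : 2 * a * dot (x - d n) y - a ^+ 2 * sqn y <= n.+1%:R^-1.
    have := Qi _ (memsubD An (memsubZ (a%:C)%C Ay)).
    rewrite -rscaleE opprD addrA sqnB sqnZ dotZr; move: hn.
    move: (n.+1%:R^-1) (inf Q) (sqn (x - d n)) (sqn y) (dot _ _) => c i p q r.
    by nra.
  have [y0|y0] := eqVneq (sqn y) 0.
    by rewrite (sqn_eq0 y0) dot0r sqn0 expr0n mulr0.
  have yp : 0 < sqn y by rewrite lt_neqAle eq_sym y0 sqn_ge0.
  (* this value of a maximizes the left-hand side of [h] *)
  rewrite -ler_pdivrMr//; apply: le_trans (h (dot (x - d n) y / sqn y)).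
  by rewrite le_eqVlt; apply/orP; left; apply/eqP; field.
Qed.

End SubspaceLemmas.

Section HilbertTopology.
Context {R : realType} {E : hilbertType R}.
Implicit Types (u v : E) (A : set E).

Lemma sqn_rnorm v : sqn v = rnorm v ^+ 2.
Proof. by rewrite /sqn /dot innerE. Qed.

Lemma rnorm_sqn_lt v (e : R) : 0 < e -> (rnorm v < e) = (sqn v < e ^+ 2).
Proof. by move=> e0; rewrite sqn_rnorm ltr_pXn2r// nnegrE ?rnorm_ge0// ltW. Qed.

Lemma ball_sqn v u (e : R) : 0 < e -> ball v (e%:C)%C u <->
  sqn (v - u) < e ^+ 2.
Proof.
by move=> e0; rewrite -ball_normE /ball_/= -rnormE ltcR rnorm_sqn_lt.
Qed.

Lemma gt0_complex (e : R[i]) : 0 < e -> exists2 r : R, 0 < r & e = (r%:C)%C.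
Proof.
move=> e0; have er : e = ((complex.Re e)%:C)%C by rewrite RRe_real// gtr0_real.
by exists (complex.Re e) => //; move: e0; rewrite {1}er (@ltcR R 0).
Qed.

Lemma nbhs_sqn v (B : set E) :
  nbhs v B <-> exists2 e : R, 0 < e & forall u, sqn (v - u) < e -> B u.
Proof.
split=> [/nbhs_ballP[e /gt0_complex[r r0 ->] h]|[e e0 h]].
  exists (r ^+ 2); first by rewrite exprn_gt0.
  by move=> u ur; apply: h; apply/ball_sqn.
apply/nbhs_ballP; exists ((Num.sqrt e)%:C)%C;
  first by rewrite /= ltcR sqrtr_gt0.
by move=> u /ball_sqn; rewrite sqrtr_gt0 sqr_sqrtr ?ltW// => /(_ e0)/h.
Qed.

(** Topology enters only through the square norm: this lemma and the next few
    translate closedness, density and completeness into epsilon statements. *)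
Lemma closed_sqn A v : closed A ->
  (forall e : R, 0 < e -> exists2 u, A u & sqn (v - u) < e) -> A v.
Proof.
move=> cA h; apply: cA => B /nbhs_sqn[e e0 hB].
by have [u Au /hB Bu] := h e e0; exists u.
Qed.

Lemma closed_seq A (d : nat -> E) v : closed A -> (forall n, A (d n)) ->
  (fun n => sqn (v - d n)) @ \oo --> (0 : R) -> A v.
Proof.
move=> cA Ad dv; apply: closed_sqn cA _ => e e0.
move/cvgrPdist_lt : dv => /(_ _ e0)[N _ /(_ _ (leqnn N))].
by rewrite sub0r normrN ger0_norm ?sqn_ge0// => h; exists (d N).
Qed.

Lemma closed_sqnP A :
  (forall v, (forall e : R, 0 < e -> exists2 u, A u & sqn (v - u) < e) ->
    A v) ->
  closed A.
Proof.
move=> h v cv; apply: h => e e0.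
have [|u [Au vu]] := cv [set u | sqn (v - u) < e]; last by exists u.
by apply/nbhs_sqn; exists e.
Qed.

Lemma dense_sqn A : dense A <->
  forall v (e : R), 0 < e -> exists2 u, A u & sqn (v - u) < e.
Proof.
split=> [dA v e e0|h O [v Ov] oO].
  have nO : nbhs v [set u | sqn (v - u) < e] by apply/nbhs_sqn; exists e.
  move: nO; rewrite nbhsE => -[B [oB Bv] BO].
  have B0 : B !=set0 by exists v.
  by have [u [Bu Au]] := dA B B0 oB; exists u => //; exact: BO.
have /nbhs_sqn[e e0 hO] : nbhs v O by apply: open_nbhs_nbhs; split.
by have [u Au /hO Ou] := h v e e0; exists u.
Qed.

(** The limit comes with a rate, the factor 4 being the price of [sqnD_le]. *)
Lemma complete_sqn (d : nat -> E) (e : nat -> R) :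
  e @ \oo --> 0 -> (forall n m, (n <= m)%N -> sqn (d n - d m) <= e n) ->
  exists v, forall n, sqn (v - d n) <= 4 * e n.
Proof.
move=> e0 de.
have /cauchy_cvg/cvg_ex[/= v dv] : cauchy (d @ \oo).
  apply/cauchyP => _ /gt0_complex[r r0 ->].
  have r2 : 0 < r ^+ 2 by rewrite exprn_gt0.
  move/cvgrPdist_lt : e0 => /(_ _ r2)[N _ hN].
  exists (d N); exists N => // m /= Nm; apply/ball_sqn => //.
  apply: le_lt_trans (de _ _ Nm) _; apply: le_lt_trans (hN _ (leqnn N)).
  by rewrite sub0r normrN ler_norm.
exists v => n.
have en0 : 0 <= e n by apply: le_trans (de _ _ (leqnn n)); exact: sqn_ge0.
have h (r : R) : 0 < r -> sqn (v - d n) <= 2 * r + 2 * e n.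
  move=> r0; have /dv[N _ hN] : nbhs v [set u | sqn (v - u) < r].
    by apply/nbhs_sqn; exists r.
  have /= h1 := hN _ (leq_maxr n N).
  have h2 := de _ _ (leq_maxl n N).
  rewrite -(subrK (d (maxn n N)) v) -addrA.
  apply: le_trans (sqnD_le _ _) _.
  by rewrite (sqn_distC (d (maxn n N))); lra.
apply/ler_addgt0Pl => r r0; have := h (r / 2); lra.
Qed.

Lemma cvg_inv_succ (c : R) : (fun n => c * n.+1%:R^-1) @ \oo --> 0.
Proof.
rewrite -[X in _ --> X](mulr0 c); apply: cvgM; first exact: cvg_cst.
exact: cvg_harmonic.
Qed.

End HilbertTopology.

(** * Orthogonal projections *)

Lemma le0_inv_succ {R : realType} (a c : R) :
  (forall n, a <= c * n.+1%:R^-1) -> a <= 0.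
Proof.
move=> h; rewrite leNgt; apply/negP => a0.
have /cvgrPdist_lt/(_ _ a0)[N _ /(_ _ (leqnn N))] := @cvg_inv_succ R c.
rewrite sub0r normrN => h1; have := h N; rewrite leNgt => /negP; apply.
exact: le_lt_trans (ler_norm _) h1.
Qed.

Lemma orth_limit {R : realType} {H : preHilbertType R} (A : set H)
    (d : nat -> H) x p :
  (forall n y, A y -> dot (x - d n) y ^+ 2 <= n.+1%:R^-1 * sqn y) ->
  (forall n, sqn (p - d n) <= 16 * n.+1%:R^-1) ->
  forall y, A y -> dot (x - p) y = 0.
Proof.
move=> dx hp y Ay.
apply/eqP; rewrite -(sqrf_eq0 (dot _ _)) eq_le sqr_ge0 andbT.
(* 34 = 2 * (1 + 16), from (a - b)^2 <= 2 a^2 + 2 b^2 *)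
apply: (@le0_inv_succ _ _ (34 * sqn y)) => n.
have h1 := dx n y Ay; have h2 := dot_sq_le (p - d n) y.
have h3 := hp n; have y0 := sqn_ge0 y.
have -> : dot (x - p) y = dot (x - d n) y - dot (p - d n) y.
  by rewrite -dotBl opprB addrA subrK.
move: h1 h2 h3; move: (n.+1%:R^-1) (dot (x - d n) y) (dot (p - d n) y) (sqn (p -
  d n)).
move=> e a b c h1 h2 h3.
have h4 : c * sqn y <= 16 * e * sqn y by rewrite ler_wpM2r//; lra.
have := sqr_ge0 (a + b); nra.
Qed.

(** Orthogonal projection onto the range of an isometry. A minimizing sequence
    in the range is pulled back to the complete space H and converges there;
    no limit is taken in K. *)
Lemma isometry_proj {R : realType} {H : hilbertType R} {K : preHilbertType R}
    (Phi : H -> K) (x : K) :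
  (forall c u v, Phi (c *: u + v) = c *: Phi u + Phi v) ->
  (forall u, sqn (Phi u) = sqn u) ->
  exists u, forall v, dot (x - Phi u) (Phi v) = 0.
Proof.
move=> linP isoP.
have PB u v : Phi (u - v) = Phi u - Phi v.
  by rewrite addrC -scaleN1r linP scaleN1r addrC.
have sA : submod_closed [in range Phi].
  split=> [|c _ _ /set_mem[u _ <-] /set_mem[v _ <-]]; apply/mem_set.
    by exists 0 => //; rewrite -(subrr (0 : H)) PB subrr.
  by exists (c *: u + v) => //; rewrite linP.
have [d [Ad dd dx]] := approx_proj sA x.
have /choice[u hu] n : exists v, Phi v = d n by have [v _ <-] := Ad n; exists v.
have [p hp] : exists p, forall n, sqn (p - u n) <= 4 * (4 * n.+1%:R^-1).
  apply: complete_sqn (@cvg_inv_succ R 4) _ => n m nm.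
  by rewrite -isoP PB !hu; exact: dd.
exists p => v; apply: (orth_limit dx) => [n|]; last by exists v.
by rewrite -hu -PB isoP (le_trans (hp n))// mulrA -natrM.
Qed.

Section Projection.
Context {R : realType} {E : hilbertType R} (A : set E).
Context (sA : submod_closed [in A]).

Lemma approx_limit x : exists (d : nat -> E) p,
  [/\ forall n, A (d n), forall n, sqn (p - d n) <= 16 * n.+1%:R^-1 &
      forall y, A y -> dot (x - p) y = 0].
Proof.
have [d [Ad dd dx]] := approx_proj sA x.
have [p hp] := complete_sqn (@cvg_inv_succ R 4) dd.
have hp' n : sqn (p - d n) <= 16 * n.+1%:R^-1.
  by rewrite (le_trans (hp n))// mulrA -natrM.
by exists d, p; split=> //; exact: orth_limit dx hp'.
Qed.

(** The limit p of a minimizing sequence for v satisfies v - p orthogonal to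
    A, hence p = v. *)
Lemma dense_of_total : (forall w, (forall y, A y -> dot w y = 0) -> w = 0) ->
  forall v (e : R), 0 < e -> exists2 u, A u & sqn (v - u) < e.
Proof.
move=> tot v e e0; have [d [p [Ad dp /tot/subr0_eq ->]]] := approx_limit v.
move/cvgrPdist_lt : (@cvg_inv_succ R 16) => /(_ _ e0)[N _ /(_ N (leqnn N))].
rewrite sub0r normrN => /(le_lt_trans (ler_norm _)) h.
by exists (d N) => //; exact: le_lt_trans (dp N) h.
Qed.

Context (cA : closed A).

Lemma projection_exists x :
  exists p, A p /\ forall y, A y -> dot (x - p) y = 0.
Proof.
have [d [p [Ad dp op]]] := approx_limit x; exists p; split=> //.
apply: closed_seq cA Ad _.
apply: (@squeeze_cvgr _ _ _ _ (cst 0) (fun n => 16 * n.+1%:R^-1)) => //.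
- by apply: nearW => n; rewrite sqn_ge0 dp.
- exact: cvg_cst.
- exact: cvg_inv_succ.
Qed.

Definition proj x := xget 0 [set p | A p /\ forall y, A y -> dot (x - p) y = 0].

Lemma projP x : A (proj x) /\ forall y, A y -> dot (x - proj x) y = 0.
Proof.
rewrite /proj; case: xgetP => [y _ //|nP].
by have [p hp] := projection_exists x; have := nP p hp.
Qed.

Lemma proj_in x : A (proj x). Proof. exact: (projP x).1. Qed.

Lemma dot_projl x y : A y -> dot (proj x) y = dot x y.
Proof. by move=> /(projP x).2; rewrite dotBl => /subr0_eq. Qed.

Lemma proj_unique x p : A p -> (forall y, A y -> dot p y = dot x y) ->
  proj x = p.
Proof.
move=> Ap hp; apply/subr0_eq/sqn_eq0; have Ax := proj_in x.
have Ad : A (proj x - p) by exact: memsubB.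
by rewrite /sqn dotBl dot_projl// hp// subrr.
Qed.

Lemma proj_id x : A x -> proj x = x.
Proof. by move=> Ax; exact: proj_unique. Qed.

Lemma projD x y : proj (x + y) = proj x + proj y.
Proof.
apply: proj_unique => [|z Az]; first by apply: memsubD => //; exact: proj_in.
by rewrite !dotDl !dot_projl.
Qed.

Lemma projZ (c : R[i]) x : proj (c *: x) = c *: proj x.
Proof.
apply: proj_unique => [|z Az]; first by apply: memsubZ => //; exact: proj_in.
by rewrite !dotZcl !dot_projl//; exact: memsubZ.
Qed.

Lemma dot_projC x y : dot (proj x) y = dot x (proj y).
Proof.
by rewrite -(dot_projl x (proj_in y)) dotC -(dot_projl y (proj_in x)) dotC.
Qed.

Lemma sqn_proj x : sqn (proj x) = dot x (proj x).
Proof. by rewrite /sqn dot_projl//; exact: proj_in. Qed.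

Lemma sqn_sub_proj x : sqn (x - proj x) = sqn x - sqn (proj x).
Proof. by rewrite sqnB -sqn_proj; lra. Qed.

Lemma sqn_proj_le x : sqn (proj x) <= sqn x.
Proof. by rewrite -subr_ge0 -sqn_sub_proj sqn_ge0. Qed.

Lemma proj_min x y : A y -> sqn (x - proj x) <= sqn (x - y).
Proof.
move=> Ay; rewrite (_ : x - y = (x - proj x) + (proj x - y)); last first.
  by rewrite addrA subrK.
rewrite (sqnD (x - proj x)) (projP x).2; last by apply: memsubB => //;
  exact: proj_in.
by rewrite mulr0 addr0 lerDl sqn_ge0.
Qed.

End Projection.

Section NestedSubspaces.
Context {R : realType} {E : hilbertType R} (N : nat -> set E).
Context (sN : forall k, submod_closed [in N k]) (cN : forall k, closed (N k)).
Context (NS : forall k, N k.+1 `<=` N k).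

Lemma nested_le k l : (k <= l)%N -> N l `<=` N k.
Proof.
move=> /subnK <-; elim: (l - k)%N => [//|n IH].
by rewrite addSn; exact: subset_trans (NS (k := _)) IH.
Qed.

(** The squared norms of the projections p k decrease to some L, and |p k - p
    l|^2 is the difference of these squares, so p k converges to a vector v of
    the intersection. Then |p k|^2 = <x, p k> = - <x, v - p k>, whose square
    is at most |x|^2 |v - p k|^2, so that L = 0. *)
Lemma proj_nested_cvg0 x :
  (forall v, (forall k, N k v) -> dot x v = 0) ->
  (fun k => sqn (proj (N k) x)) @ \oo --> 0.
Proof.
move=> xN; pose p k := proj (N k) x; pose s k := sqn (p k).
have pkl k l : (k <= l)%N -> sqn (p k - p l) = s k - s l.
  move=> kl; rewrite sqnB /p dot_projl//; last by apply: (nested_le kl);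
    exact: proj_in.
  by rewrite -sqn_proj// /s; lra.
have s_dec : {homo s : k l / (k <= l)%N >-> l <= k}.
  by move=> k l kl; rewrite -subr_ge0 -pkl// sqn_ge0.
have sl : has_lbound (range s) by exists 0 => _ [k _ <-]; exact: sqn_ge0.
have s_cvg := nonincreasing_cvgn s_dec sl.
set L := inf (range s) in s_cvg.
have Ls k : L <= s k by apply: ge_inf => //; exists k.
have e0 : (fun k => s k - L) @ \oo --> 0.
  by rewrite -(subrr L); apply: cvgB => //; exact: cvg_cst.
have [v hv] : exists v, forall n, sqn (v - p n) <= 4 * (s n - L).
  apply: complete_sqn e0 _ => n m nm.
  by rewrite pkl// lerB.
have e04 : (fun k => 4 * (s k - L)) @ \oo --> 0.
  by rewrite -(mulr0 4); apply: cvgM => //; exact: cvg_cst.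
have vN k : N k v.
  apply: (@closed_seq _ _ (N k) (fun n => p (maxn k n))) => //.
    by move=> n; apply: (nested_le (leq_maxl k n)); exact: proj_in.
  apply: (@squeeze_cvgr _ _ _ _ (cst 0) (fun n => 4 * (s n - L))) => //.
  - near=> n; rewrite sqn_ge0 /=; have kn : (k <= n)%N by near: n; exists k.
    by rewrite (maxn_idPr kn) hv.
  - exact: cvg_cst.
suff -> : 0 = L by [].
have h k : s k ^+ 2 <= sqn x * (4 * (s k - L)).
  rewrite {1}(_ : s k = - dot x (v - p k)); last first.
    by rewrite dotBr xN// sub0r opprK /s sqn_proj.
  rewrite sqrrN; apply: le_trans (dot_sq_le _ _) _.
  by apply: ler_wpM2l; [exact: sqn_ge0|exact: hv].
have : L ^+ 2 <= 0.
  have c1 : (fun k => s k ^+ 2) @ \oo --> L ^+ 2 by exact: cvgM.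
  have c2 : (fun k => sqn x * (4 * (s k - L))) @ \oo --> 0.
    by rewrite -(mulr0 (sqn x)); apply: cvgM => //; exact: cvg_cst.
  by apply: (ler_cvg_to c1 c2); apply: nearW => k; exact: h.
by move=> L2; apply/esym/eqP; rewrite -(sqrf_eq0 L) eq_le L2 sqr_ge0.
Unshelve. all: by end_near. Qed.

End NestedSubspaces.

(** * The orbit of the exponential vectors is total *)

Section Auxiliary.
Context {R : realType} {E : hilbertType R}.

Lemma closed_fix (T : E -> E) (C : R) : (forall x y, T (x - y) = T x - T y) ->
  (forall x, sqn (T x) <= C * sqn x) -> closed [set v | T v = v].
Proof.
move=> TB Tb; apply: closed_sqnP => v hv; apply/subr0_eq/sqn_eq0.
apply/eqP; rewrite eq_le sqn_ge0 andbT; apply/ler_addgt0Pl => e e0;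
  rewrite addr0.
have C0 : 0 <= `|C| by [].
have c0 : 0 < 2 * `|C| + 2 by lra.
have [u /= Tu vu] := hv (e / (2 * `|C| + 2)) (divr_gt0 e0 c0).
have -> : T v - v = T (v - u) + (u - v) by rewrite TB Tu addrA subrK.
apply: le_trans (sqnD_le _ _) _; rewrite (sqn_distC u).
move: vu; rewrite ltr_pdivlMr// => vu.
have := Tb (v - u); have : C * sqn (v - u) <= `|C| * sqn (v - u).
  by apply: ler_wpM2r; [exact: sqn_ge0|exact: ler_norm].
nra.
Qed.

(** The index N + j - i plays the role of j - i, shifted to stay in nat: for j
    < N these are N distinct indices below 2N. *)
Lemma sum_window (F : nat -> R) N j : (j < N)%N -> (forall r, 0 <= F r) ->
  \sum_(i < N) F (N + j - i)%N <= \sum_(r < N.*2) F r.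
Proof.
move=> jN F0; rewrite (reindex_inj rev_ord_inj) /=.
have -> : \sum_(i < N) F (N + j - (N - i.+1))%N =
  \sum_(j.+1 <= r < N + j.+1) F r.
  rewrite -[j.+1 in X in _ = X]add0n big_addn addnK big_mkord.
  by apply: eq_bigr => i _; congr F; have := ltn_ord i; lia.
rewrite -(big_mkord xpredT F) (@big_cat_nat _ _ _ j.+1 0 N.*2)//=; last by lia.
rewrite (@big_cat_nat _ _ _ (N + j.+1) j.+1 N.*2)//=; [|by lia..].
have h (a b : nat) : 0 <= \sum_(a <= r < b) F r by apply: sumr_ge0 => r _.
have := h 0%N j.+1; have := h (N + j.+1)%N N.*2; lra.
Qed.

Lemma small_pow h (e : R) : 0 < h -> 0 < e -> exists k, h / 2 ^+ k < e.
Proof.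
move=> h0 e0; pose k := (Num.truncn (h / e)).+1; exists k.
rewrite ltr_pdivrMr ?exprn_gt0// mulrC -ltr_pdivrMr//.
apply: (@lt_trans _ _ k%:R); first by rewrite /k truncnS_gt.
by rewrite -natrX ltr_nat ltn_expl.
Qed.

End Auxiliary.

Section TranslationGroup.
Context {R : realType} {E : hilbertType R} (Ep : set E) (U : R -> E -> E).
Context (sEp : submod_closed [in Ep]) (cEp : closed Ep).
Context (gU : unitary_one_parameter_group U).
Context (Umono : forall t, 0 < t -> U t @` Ep `<=` Ep).
Implicit Types (t s a b c d h : R) (u v w x y z m : E).

Lemma flow0 v : U 0 v = v. Proof. by have [_ /(_ v) -> _ _] := gU. Qed.
Lemma flowD s t v : U (s + t) v = U s (U t v).
Proof. by have [_ _ /(_ s t v) -> _] := gU. Qed.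
Lemma flow_linear t (c : R[i]) u v : U t (c *: u + v) = c *: U t u + U t v.
Proof. by have [/(_ t)[linU _ _] _ _ _] := gU; exact: linU. Qed.
Lemma flow_add t u v : U t (u + v) = U t u + U t v.
Proof. by rewrite -[u in LHS]scale1r flow_linear scale1r. Qed.
Lemma flow_zero t : U t 0 = 0.
Proof. by apply: (addrI (U t 0)); rewrite -flow_add !addr0. Qed.
Lemma flowZ t (c : R[i]) u : U t (c *: u) = c *: U t u.
Proof. by rewrite -[c *: u in LHS]addr0 flow_linear flow_zero addr0. Qed.
Lemma flowN t u : U t (- u) = - U t u.
Proof. by rewrite -scaleN1r flowZ scaleN1r. Qed.
Lemma flowB t u v : U t (u - v) = U t u - U t v.
Proof. by rewrite flow_add flowN. Qed.
Lemma flow_rscale t a u : U t (rscale a u) = rscale a (U t u).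
Proof. exact: flowZ. Qed.
Lemma dot_flow t u v : dot (U t u) (U t v) = dot u v.
Proof. by have [/(_ t)[_ isoU _] _ _ _] := gU; rewrite /dot isoU. Qed.
Lemma sqn_flow t u : sqn (U t u) = sqn u. Proof. exact: dot_flow. Qed.
Lemma flowK t v : U t (U (- t) v) = v.
Proof. by rewrite -flowD subrr flow0. Qed.
Lemma flowNK t v : U (- t) (U t v) = v.
Proof. by rewrite -flowD addNr flow0. Qed.
Lemma dot_flowl t u v : dot (U t u) v = dot u (U (- t) v).
Proof. by rewrite -[in LHS](flowK t v) dot_flow. Qed.

Lemma flow_sub t z : 0 <= t -> Ep z -> Ep (U t z).
Proof.
rewrite le_eqVlt => /predU1P[<-|t0] Ez; first by rewrite flow0.
by apply: (Umono t0); exists z.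
Qed.

Lemma flow_near v (e : R) : 0 < e ->
  exists2 d : R, 0 < d & forall t, `|t| < d -> sqn (v - U t v) < e.
Proof.
move=> e0; have [_ _ _ cU] := gU.
have /(cU v 0) : nbhs (U 0 v) [set u | sqn (v - u) < e].
  by apply/nbhs_sqn; exists e => // u; rewrite flow0.
move=> /nbhs_ballP[d d0 hd]; exists d => // t td.
by apply: hd; rewrite -ball_normE /ball_/= sub0r normrN.
Qed.

(** The translations weighted by e^{-t/2}: in the model, the function e_0 (x)
    m restricted to [t, oo[ is its own weighted translate by t. *)
Definition damp t v : E := rscale (expR (- t / 2)) (U t v).

Lemma damp0 v : damp 0 v = v.
Proof. by rewrite /damp oppr0 mul0r expR0 rscale1 flow0. Qed.
Lemma dampD s t v : damp (s + t) v = damp s (damp t v).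
Proof.
rewrite /damp flow_rscale rscaleA flowD -expRD; congr (rscale (expR _) _).
by rewrite opprD mulrDl.
Qed.
Lemma damp_add t u v : damp t (u + v) = damp t u + damp t v.
Proof. by rewrite /damp flow_add rscaleDr. Qed.
Lemma dampZ t (c : R[i]) u : damp t (c *: u) = c *: damp t u.
Proof. by rewrite /damp flowZ /rscale !scalerA mulrC. Qed.
Lemma dampN t u : damp t (- u) = - damp t u.
Proof. by rewrite /damp flowN rscaleNr. Qed.
Lemma dampB t u v : damp t (u - v) = damp t u - damp t v.
Proof. by rewrite damp_add dampN. Qed.
Lemma damp_zero t : damp t 0 = 0.
Proof. by rewrite /damp flow_zero rscale0. Qed.
Lemma damp_sum t n (F : 'I_n -> E) :
  damp t (\sum_(i < n) F i) = \sum_(i < n) damp t (F i).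
Proof.
by apply: (big_morph (damp t)) => [u v|]; [exact: damp_add|exact: damp_zero].
Qed.
Lemma sqn_damp t u : sqn (damp t u) = expR (- t) * sqn u.
Proof.
by rewrite /damp sqnZ sqn_flow expr2 -expRD; congr (expR _ * _); field.
Qed.
Lemma damp_sub t z : 0 <= t -> Ep z -> Ep (damp t z).
Proof. by move=> t0 Ez; apply: memsubZ => //; exact: flow_sub. Qed.

Lemma damp_near v (e : R) : 0 < e ->
  exists2 d : R, 0 < d & forall t, `|t| < d -> sqn (v - damp t v) < e.
Proof.
move=> e0; have e4 : 0 < e / 4 by lra.
have [d1 d10 h1] := flow_near v e4.
have c0 : (fun t : R => expR (- t / 2)) t @[t --> (0 : R)] --> (1 : R).
  rewrite -[X in _ --> X]expR0 -[0 in X in _ --> X](mul0r (2^-1)) -[in X in _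
    --> X]oppr0.
  apply: continuous_cvg; first exact: continuous_expR.
  by apply: cvgM; [apply: cvgN; exact: cvg_id|exact: cvg_cst].
pose r := e / (4 * (sqn v + 1)).
have v0 := sqn_ge0 v.
have r0 : 0 < r by rewrite divr_gt0//; lra.
have q0 : 0 < Num.sqrt r by rewrite sqrtr_gt0.
move/cvgrPdist_lt : c0 => /(_ _ q0) /nbhs_ballP[d2 /= d20 h2].
exists (Num.min d1 d2); first by rewrite lt_min d10.
move=> t; rewrite lt_min => /andP[/h1 ht1 ht2].
have := h2 t; rewrite -ball_normE /ball_/= sub0r normrN => /(_ ht2) ht3.
have -> : v - damp t v = (v - U t v) + rscale (1 - expR (- t / 2)) (U t v).
  rewrite /damp rscaleDl rscale1 addrA subrK; congr (_ + _).
  by rewrite /rscale raddfN scaleNr.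
apply: le_lt_trans (sqnD_le _ _) _; rewrite sqnZ sqn_flow.
have h4 : (1 - expR (- t / 2)) ^+ 2 < r.
  by rewrite -(sqr_sqrtr (ltW r0)) -real_normK ?num_real// ltr_pXn2r// nnegrE//
    ltW.
have h5 : r * sqn v <= e / 4.
  rewrite /r -mulrA ler_pM2l// invfM -mulrA -[leRHS]mulr1 ler_pM2l ?invr_gt0//.
  by rewrite mulrC ler_pdivrMr; lra.
have h6 : (1 - expR (- t / 2)) ^+ 2 * sqn v <= r * sqn v.
  by apply: ler_wpM2r => //; exact: ltW.
by lra.
Qed.

(** Orthogonal projection onto U_t Ep; in the model, multiplication by the
    indicator of [t, oo[. *)
Definition future t x : E := U t (proj Ep (U (- t) x)).

Lemma future_add t x y : future t (x + y) = future t x + future t y.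
Proof. by rewrite /future flow_add projD// flow_add. Qed.
Lemma futureZ t (c : R[i]) x : future t (c *: x) = c *: future t x.
Proof. by rewrite /future flowZ projZ// flowZ. Qed.
Lemma futureN t x : future t (- x) = - future t x.
Proof. by rewrite -scaleN1r futureZ scaleN1r. Qed.
Lemma future_flow t s x : future t (U s x) = U s (future (t - s) x).
Proof. by rewrite /future -!flowD; congr (U _ (proj Ep (U _ x))); ring. Qed.
Lemma future_id t x : Ep (U (- t) x) -> future t x = x.
Proof. by move=> Ex; rewrite /future proj_id// flowK. Qed.
Lemma future_in t x : Ep (U (- t) (future t x)).
Proof. by rewrite /future flowNK; exact: proj_in. Qed.
Lemma dot_future t x y : dot (future t x) y = dot x (future t y).
Proof. by rewrite /future dot_flowl dot_projC// dot_flowl opprK. Qed.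
Lemma future_le s t x : s <= t -> future s (future t x) = future t x.
Proof.
move=> st; apply: future_id; have -> : - s = (t - s) - t by ring.
by rewrite flowD; apply: flow_sub; [rewrite subr_ge0|exact: future_in].
Qed.
Lemma future_ge s t x : s <= t -> future t (future s x) = future t x.
Proof. by move=> st; apply: dot_ext => w; rewrite !dot_future future_le. Qed.
Lemma sqn_future t x : sqn (future t x) = dot x (future t x).
Proof. by rewrite /sqn dot_future future_le. Qed.
Lemma sqn_future_le t x : sqn (future t x) <= sqn x.
Proof.
by rewrite /future sqn_flow; apply: le_trans (sqn_proj_le sEp cEp _) _;
  rewrite sqn_flow.
Qed.

(** In the model, multiplication by the indicator of [a, b[. *)
Definition slab a b x : E := future a x - future b x.

Lemma slab_add a b x y : slab a b (x + y) = slab a b x + slab a b y.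
Proof. by rewrite /slab !future_add opprD addrACA. Qed.
Lemma slabZ a b (c : R[i]) x : slab a b (c *: x) = c *: slab a b x.
Proof. by rewrite /slab !futureZ scalerBr. Qed.
Lemma slabN a b x : slab a b (- x) = - slab a b x.
Proof. by rewrite -scaleN1r slabZ scaleN1r. Qed.
Lemma slabB a b x y : slab a b (x - y) = slab a b x - slab a b y.
Proof. by rewrite slab_add slabN. Qed.
Lemma slab_zero a b : slab a b 0 = 0.
Proof. by have := slabZ a b 0 0; rewrite !scale0r. Qed.
Lemma slab_sum a b n (F : 'I_n -> E) :
  slab a b (\sum_(i < n) F i) = \sum_(i < n) slab a b (F i).
Proof.
by apply: (big_morph (slab a b)) => [u v|]; [exact: slab_add|exact: slab_zero].
Qed.
Lemma slab_flow a b s x : slab a b (U s x) = U s (slab (a - s) (b - s) x).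
Proof. by rewrite /slab !future_flow flowB. Qed.
Lemma slab_damp a b s x : slab a b (damp s x) = damp s (slab (a - s) (b - s) x).
Proof. by rewrite /damp /rscale slabZ slab_flow. Qed.
Lemma dot_slab a b x y : dot (slab a b x) y = dot x (slab a b y).
Proof. by rewrite /slab dotBl dotBr !dot_future. Qed.

(** The projections commute like indicators of nested intervals; by duality
    this is equivalent to [slab_big]. *)
Lemma slab_small a b c d x : a <= c -> c <= d -> d <= b ->
  slab c d (slab a b x) = slab c d x.
Proof.
move=> ac cd db; rewrite /slab !future_add !futureN !(future_ge _ ac)
  (future_ge _ (le_trans ac cd)).
by rewrite (future_le _ db) (future_le _ (le_trans cd db)) opprB addrA subrK.
Qed.
Lemma slab_big a b c d x : a <= c -> c <= d -> d <= b ->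
  slab a b (slab c d x) = slab c d x.
Proof.
by move=> ac cd db; apply: dot_ext => w; rewrite !dot_slab slab_small.
Qed.
Lemma slab_slab0 a b c d x : a <= b -> b <= c -> c <= d ->
  slab a b (slab c d x) = 0.
Proof.
move=> ab bc cd; rewrite /slab !future_add !futureN !(future_le _ bc)
  (future_le _ (le_trans ab bc)).
by rewrite (future_le _ (le_trans bc cd)) (future_le _ (le_trans ab (le_trans
  bc cd))) subrr.
Qed.
Lemma slab_orth a b c d x y : a <= b -> b <= c -> c <= d ->
  dot (slab a b x) (slab c d y) = 0.
Proof. by move=> ab bc cd; rewrite dot_slab slab_slab0// dot0r. Qed.
Lemma sqn_slab a b x : a <= b -> sqn (slab a b x) =
  sqn (future a x) - sqn (future b x).
Proof.
move=> ab; rewrite /sqn dot_slab slab_big// {1}/slab dotBr.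
by rewrite -!sqn_future.
Qed.
Lemma sqn_slab_le a b x : a <= b -> sqn (slab a b x) <= sqn x.
Proof.
move=> ab; rewrite sqn_slab//; have := sqn_future_le a x;
  have := sqn_ge0 (future b x); lra.
Qed.
Lemma slab_sub b x : 0 <= b -> Ep (slab 0 b x).
Proof.
move=> b0; rewrite -(slab_big x (lexx 0) b0 (lexx b)) {1}/slab.
rewrite /future oppr0 !flow0; apply: memsubB => //; first exact: proj_in.
by apply: flow_sub => //; exact: proj_in.
Qed.

(** For u living on [0, d[, this is the continuation of u to n cells of length
    d by the rule F(x + d) = e^{-d/2} F(x). *)
Definition spread d n u : E := \sum_(j < n) damp (j%:R * d) u.

(** The vectors obtained by spreading their first cell. Writing them as fixed
    points of a bounded operator makes closedness immediate. *)
Definition qper d n : set E := [set v | spread d n (slab 0 d v) = v].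

Lemma spreadB d n u v : spread d n (u - v) = spread d n u - spread d n v.
Proof. by rewrite /spread -sumrB; apply: eq_bigr => j _; rewrite dampB. Qed.
Lemma spreadPE d n (c : R[i]) u v :
  spread d n (c *: u + v) = c *: spread d n u + spread d n v.
Proof.
rewrite /spread scaler_sumr -big_split; apply: eq_bigr => j _.
by rewrite damp_add dampZ.
Qed.

Lemma spread_le d n u : 0 <= d -> sqn (spread d n u) <= n%:R ^+ 2 * sqn u.
Proof.
move=> d0; rewrite /spread; apply: le_trans (sqn_sum_le _ (fun j =>
  damp (j%:R * d) u)) _.
rewrite expr2 -mulrA ler_wpM2l// mulr_natl -[X in _ *+ X]card_ord -sumr_const.
apply: ler_sum => j _; rewrite sqn_damp -[leRHS]mul1r ler_wpM2r ?sqn_ge0//.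
by rewrite -expR0 ler_expR oppr_le0 mulr_ge0.
Qed.

Lemma qper_submod d n : submod_closed [in qper d n].
Proof.
split; first by apply/mem_set; rewrite /qper/= slab_zero -[0]/(0 : E) /spread
  big1// => j _; rewrite damp_zero.
move=> c u v /set_mem Hu /set_mem Hv; apply/mem_set; rewrite /qper/=.
by rewrite slab_add slabZ spreadPE Hu Hv.
Qed.

Lemma qper_closed d n : 0 <= d -> closed (qper d n).
Proof.
move=> d0; apply: (@closed_fix _ _ _ (n%:R ^+ 2)) => [x y|x].
  by rewrite slabB spreadB.
apply: le_trans (spread_le _ _ d0) _; apply: ler_wpM2l; first exact: sqr_ge0.
exact: sqn_slab_le.
Qed.

Lemma slab_spread d n u : 0 <= d -> slab 0 d u = u ->
  slab 0 d (spread d n.+1 u) = u.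
Proof.
move=> d0 Qu; rewrite /spread slab_sum big_ord_recl big1 => [|j _].
  by rewrite addr0 mul0r damp0.
rewrite slab_damp -Qu slab_slab0 ?damp_zero// ?lerD2r// lift0 -natr1 mulrDl
  mul1r.
have : 0 <= j%:R * d by rewrite mulr_ge0.
lra.
Qed.

Lemma spread_double d n u : spread d n.*2 u = spread (2 * d) n (u + damp d u).
Proof.
rewrite /spread; elim: n => [|n IH]; first by rewrite !big_ord0.
rewrite doubleS !big_ord_recr /= IH -addrA damp_add -dampD.
have e : (n.*2)%:R = 2 * n%:R :> R by rewrite -mul2n natrM.
by congr (_ + (damp _ _ + damp _ _)); rewrite ?natrS -?natr1 e; ring.
Qed.

(** A vector that repeats on cells of length d also repeats on cells of length
    2d, whose content is made of two consecutive small cells. *)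
Lemma qper_double d n : 0 <= d -> (0 < n)%N -> qper d n.*2 `<=` qper (2 * d) n.
Proof.
move=> d0; case: n => // n _ v; rewrite /qper /= spread_double => Hv.
set u := slab 0 d v in Hv; rewrite -{1}Hv slab_spread//;
  first by rewrite mulr_ge0.
have Qu : slab (- d) d u = u by rewrite slab_big// oppr_le0.
rewrite slab_add {1}/u slab_big//; last by lra.
rewrite slab_damp sub0r (_ : 2 * d - d = d); last by ring.
by rewrite Qu.
Qed.

(** Comes from <x, U_h x> <= |x|^2: for h > 0 the factor e^{-h/2} < 1 keeps 1
    away from the spectrum of [damp h]. *)
Lemma sqn_sub_damp_ge h x : (1 - expR (- h / 2)) ^+ 2 * sqn x <=
  sqn (x - damp h x).
Proof.
rewrite sqnB sqn_damp /damp dotZr.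
have -> : expR (- h) = expR (- h / 2) ^+ 2.
  by rewrite expr2 -expRD; congr expR; field.
have := sqn_ge0 (x - U h x); rewrite sqnB sqn_flow.
have := expR_ge0 (- h / 2); nra.
Qed.

Lemma damp_fixed_eq0 h x : 0 < h -> x = damp h x -> x = 0.
Proof.
move=> h0 xW; apply/sqn_eq0/eqP; rewrite eq_le sqn_ge0 andbT.
have := sqn_sub_damp_ge h x; rewrite -xW subrr sqn0.
have r1 : expR (- h / 2) < 1 by rewrite expR_lt1; lra.
by rewrite pmulr_rle0// exprn_gt0// subr_gt0.
Qed.

Lemma spread_sub_damp d n u :
  spread d n u - damp d (spread d n u) = u - damp (n%:R * d) u.
Proof.
elim: n => [|n IH].
  by rewrite /spread big_ord0 damp_zero subrr mul0r damp0 subrr.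
rewrite /spread big_ord_recr /= damp_add opprD addrACA -/(spread d n u) IH
  -dampD.
rewrite addrA subrK (_ : d + n%:R * d = n.+1%:R * d)// -natr1; ring.
Qed.

Lemma spread_cat d n j u : spread d (n + j) u =
  spread d n u + damp (n%:R * d) (spread d j u).
Proof.
rewrite /spread big_split_ord /= damp_sum; congr (_ + _);
  apply: eq_bigr => i _ /=.
by rewrite -dampD natrD mulrDl.
Qed.

(** The geometric series of [damp h]. Its partial sums are bounded because
    applying 1 - damp h telescopes them, and the tail after n terms is the
    n-th power of [damp h] applied to a partial sum. *)
Lemma solve_sub_damp h v : 0 < h -> Ep v -> exists2 m, Ep m & m - damp h m = v.
Proof.
move=> h0 Ev; pose r := expR (- h / 2).
have r1 : r < 1 by rewrite expR_lt1; lra.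
have r2 : 0 < (1 - r) ^+ 2 by rewrite exprn_gt0// subr_gt0.
pose C := 4 * sqn v / (1 - r) ^+ 2.
have Cb n : sqn (spread h n v) <= C.
  rewrite ler_pdivlMr// mulrC; apply: le_trans (sqn_sub_damp_ge _ _) _.
  rewrite spread_sub_damp; apply: le_trans (sqnD_le _ _) _.
  rewrite sqnN sqn_damp; have : expR (- (n%:R * h)) <= 1.
    by rewrite -expR0 ler_expR oppr_le0 mulr_ge0// ltW.
  have := sqn_ge0 v; nra.
pose e n := C * expR (- h) ^+ n.
have e0 : e @ \oo --> 0.
  rewrite -(mulr0 C); apply: cvgM; first exact: cvg_cst.
  by apply: cvg_expr; rewrite ger0_norm ?expR_ge0// expR_lt1 oppr_lt0.
have [m hm] : exists m, forall n, sqn (m - spread h n v) <= 4 * e n.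
  apply: complete_sqn e0 _ => n l /subnKC <-.
  rewrite spread_cat opprD addrA subrr sub0r sqnN sqn_damp /e mulrC.
  rewrite -mulrN expRM_natl; apply: ler_wpM2r;
    [exact: exprn_ge0 (expR_ge0 _)|exact: Cb].
have e04 : (fun k => 4 * e k) @ \oo --> 0.
  by rewrite -(mulr0 4); apply: cvgM => //; exact: cvg_cst.
exists m.
  apply: (@closed_seq _ _ Ep (fun n => spread h n v)) => //.
    move=> n; apply: (@memsub_sum _ _ Ep sEp n (fun j => damp (j%:R * h) v)) =>
      j.
    by apply: damp_sub => //; rewrite mulr_ge0// ltW.
  apply: (@squeeze_cvgr _ _ _ _ (cst 0) (fun n => 4 * e n)) => //.
  - by apply: nearW => n; rewrite sqn_ge0 hm.
  - exact: cvg_cst.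
apply/subr0_eq/sqn_eq0/eqP; rewrite eq_le sqn_ge0 andbT.
(* the square norm of [m - damp h m - v] is at most 2 * (4 * 4 + 1) * e n *)
have c0 : (fun n => 40 * e n) @ \oo --> 0.
  by rewrite -(mulr0 40); apply: cvgM => //; exact: cvg_cst.
apply: (ler_cvg_to (cvg_cst _) c0); apply: nearW => n /=.
pose y := m - spread h n v.
have -> : m - damp h m - v = (y - damp h y) + (- damp (n%:R * h) v).
  have hs := spread_sub_damp h n v; apply: dot_ext => w.
  have := congr1 (dot^~ w) hs; rewrite /y dampB !dotE; lra.
apply: le_trans (sqnD_le _ _) _; rewrite sqnN sqn_damp.
have yW : sqn (y - damp h y) <= 4 * sqn y.
  apply: le_trans (sqnD_le _ _) _; rewrite sqnN sqn_damp.
  have : expR (- h) <= 1 by rewrite -expR0 ler_expR oppr_le0 ltW.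
  have := sqn_ge0 y; nra.
have vC : sqn v <= C.
  rewrite /C ler_pdivlMr//; have := expR_ge0 (- h / 2); rewrite -/r => r0.
  have r3 : (1 - r) ^+ 2 <= 4 by nra.
  by rewrite mulrC; apply: ler_wpM2r => //; exact: sqn_ge0.
rewrite -mulrN expRM_natl.
have := hm n; rewrite -/y /e.
have := exprn_ge0 n (expR_ge0 (- h)); move: (expR (- h) ^+ n) => q q0.
have : q * sqn v <= q * C by exact: ler_wpM2l.
have : 0 <= C * q by rewrite mulr_ge0// (le_trans _ vC)// sqn_ge0.
lra.
Qed.

(** In the model, the vectors e_0 (x) m, where e_0(x) = e^{-x/2} on [0, oo[.
    Equivalently, the eigenvectors for e^{-t/2} of the adjoints of the
    semigroup of isometries induced by U on Ep. *)
Definition expspace : set E := [set m | Ep m /\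
  forall t z, 0 <= t -> Ep z -> dot m (U t z) = expR (- t / 2) * dot m z].

Lemma expspace_submod : submod_closed [in expspace].
Proof.
split; first by apply/mem_set; split;
  [exact: memsub0|move=> t z _ _; rewrite !dot0l mulr0].
move=> c u v /set_mem[Eu Hu] /set_mem[Ev Hv]; apply/mem_set; split.
  exact: memsubZD.
move=> t z t0 Ez; rewrite !dotDl !dotZcl -flowZ Hu ?Hv//; last exact: memsubZ.
by rewrite mulrDr.
Qed.

Lemma expspace_closed : closed expspace.
Proof.
apply: closed_sqnP => v hv; split.
  apply: closed_sqn cEp _ => e e0; have [u [Eu _] uv] := hv e e0; by exists u.
move=> t z t0 Ez; apply/subr0_eq/eqP.
rewrite -(sqrf_eq0 (_ - _)) eq_le sqr_ge0 andbT.
apply/ler_addgt0Pl => e e0; rewrite addr0.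
have z0 := sqn_ge0 z; have p0 : 0 < 4 * (sqn z + 1) by lra.
have [u [_ Hu] uv] := hv (e / (4 * (sqn z + 1))) (divr_gt0 e0 p0).
have -> : dot v (U t z) - expR (- t / 2) * dot v z =
    dot (v - u) (U t z) - expR (- t / 2) * dot (v - u) z.
  by rewrite !dotBl Hu//; ring.
move: uv; rewrite ltr_pdivlMr// => uv.
have h1 := dot_sq_le (v - u) (U t z); have h2 := dot_sq_le (v - u) z.
rewrite sqn_flow in h1.
have r0 := expR_ge0 (- t / 2).
have r1 : expR (- t / 2) <= 1 by rewrite expR_le1; lra.
have := sqn_ge0 (v - u).
move: h1 h2 r0 r1 uv; move: (dot _ _) (dot _ _) (expR _) (sqn _) => b a r q.
move=> h1 h2 r0 r1 uv q0.
have h3 : (r * b) ^+ 2 <= q * sqn z.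
  by rewrite exprMn; apply: le_trans h2; rewrite ler_piMl ?sqr_ge0// expr_le1.
have := sqr_ge0 (a + r * b); nra.
Qed.

(** Translating back by the smaller of the two times brings the definition of
    [expspace] into play. *)
Lemma dot_expspace s t m m' : expspace m -> expspace m' ->
  dot (U s m) (U t m') = expR (- `|t - s| / 2) * dot m m'.
Proof.
wlog st : s t m m' / s <= t => [wl|].
  move=> Mm Mm'; have [st|/ltW st] := leP s t; first exact: wl.
  by rewrite dotC distrC (dotC m); exact: wl.
move=> [_ Hm] [Em' _]; rewrite ger0_norm ?subr_ge0// dot_flowl -flowD addrC.
by apply: Hm => //; rewrite subr_ge0.
Qed.

(** The relation passes from a step to its multiples because U_t Ep is
    contained in Ep, and to all times by strong continuity. *)
Lemma expspace_dyadic h m : 0 < h -> Ep m ->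
  (forall k z, Ep z ->
     dot m (U (h / 2 ^+ k) z) = expR (- (h / 2 ^+ k) / 2) * dot m z) ->
  expspace m.
Proof.
move=> h0 Em Hm; split=> // t z t0 Ez.
have dk k : 0 < h / 2 ^+ k by rewrite divr_gt0// exprn_gt0.
have step k j y : Ep y -> dot m (U (j%:R * (h / 2 ^+ k)) y) =
    expR (- (j%:R * (h / 2 ^+ k)) / 2) * dot m y.
  elim: j => [|j IH] Ey; first by rewrite !mul0r oppr0 mul0r expR0 mul1r flow0.
  rewrite -natr1 mulrDl mul1r addrC flowD Hm; last by apply: flow_sub;
    rewrite // mulr_ge0// ltW.
  by rewrite IH// mulrA -expRD -mulrDl -opprD.
apply/subr0_eq/eqP; rewrite -(sqrf_eq0 (_ - _)) eq_le sqr_ge0 andbT.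
apply/ler_addgt0Pl => e e0; rewrite addr0.
have z0 := sqn_ge0 z; have p0 : 0 < sqn z + 1 by lra.
have [r r0 hr] := damp_near m (divr_gt0 e0 p0).
have [k kr] := small_pow h0 r0.
pose j := Num.truncn (t / (h / 2 ^+ k)).
have /andP[j1 j2] := truncn_itv (divr_ge0 t0 (ltW (dk k))).
rewrite -/j ler_pdivlMr// in j1;
  rewrite -/j ltr_pdivrMr// -natr1 mulrDl mul1r in j2.
set tk := j%:R * (h / 2 ^+ k) in j1 j2.
have [s0 sr] : 0 <= t - tk /\ t - tk < r by lra.
have -> : dot m (U t z) - expR (- t / 2) * dot m z =
   - expR (- t / 2) * dot (m - damp (- (t - tk)) m) z.
  have -> : U t z = U tk (U (t - tk) z) by rewrite -flowD addrC subrK.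
  rewrite /tk step; last by apply: flow_sub.
  rewrite -/tk /damp dotBl dotZl dot_flowl !opprK.
  have -> : expR (- tk / 2) = expR (- t / 2) * expR ((t - tk) / 2).
    by rewrite -expRD; congr expR; field.
  by ring.
rewrite exprMn sqrrN.
have h1 := dot_sq_le (m - damp (- (t - tk)) m) z.
have h2 : sqn (m - damp (- (t - tk)) m) < e / (sqn z + 1).
  by apply: hr; rewrite normrN ger0_norm.
rewrite ltr_pdivlMr// in h2.
have r1 : expR (- t / 2) ^+ 2 <= 1.
  by rewrite expr_le1 ?expR_ge0// expR_le1; lra.
apply: (@le_trans _ _ (dot (m - damp (- (t - tk)) m) z ^+ 2)).
  by rewrite ler_piMl// sqr_ge0.
apply: le_trans h1 _; have := sqn_ge0 (m - damp (- (t - tk)) m); nra.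
Qed.

Definition dyadic_qper h k : set E := qper (h / 2 ^+ k) (2 ^ k).

Lemma dyadic_qper_nested h k : 0 < h -> dyadic_qper h k.+1 `<=` dyadic_qper h k.
Proof.
move=> h0; rewrite /dyadic_qper expnS mul2n.
have -> : h / 2 ^+ k = 2 * (h / 2 ^+ k.+1).
  by rewrite exprS; field; rewrite expf_neq0.
apply: qper_double; last by rewrite expn_gt0.
by rewrite divr_ge0 ?exprn_ge0// ltW.
Qed.

(** The vector m is the damped repetition of v along all intervals of length
    h. At each scale d it is also the repetition of the first cell u of v, so
    that m = u + damp d m; as u is orthogonal to U_d Ep this is the
    eigenvector relation at time d. *)
Lemma dyadic_qper_expspace h v : 0 < h -> (forall k, dyadic_qper h k v) ->
  [/\ slab 0 h v = v & exists2 m, expspace m & v = m - damp h m].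
Proof.
move=> h0 Hv.
have Qv : slab 0 h v = v.
  have := Hv 0%N; rewrite /dyadic_qper /qper /= expr0 divr1 /spread
    big_ord_recl.
  by rewrite big_ord0 addr0 mul0r damp0.
have Ev : Ep v by rewrite -Qv; apply: slab_sub; exact: ltW.
split=> //; have [m Em mv] := solve_sub_damp h0 Ev; exists m => //.
apply: (expspace_dyadic h0 Em) => k z Ez.
set d := h / 2 ^+ k.
have d0 : 0 < d by rewrite divr_gt0// exprn_gt0.
have Nd : (2 ^ k)%:R * d = h.
  by rewrite natrX /d mulrC divfK// expf_neq0.
have := Hv k; rewrite /dyadic_qper /qper /= -/d; set u := slab 0 d v => uv.
(* both sides solve the same equation for [damp h],
  which has a unique solution *)
have mu : m = u + damp d m.
  apply/subr0_eq; apply: (damp_fixed_eq0 h0); apply/subr0_eq.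
  have e1 := spread_sub_damp d (2 ^ k) u; rewrite uv Nd in e1.
  have e2 := congr1 (damp d) mv; rewrite dampB in e2.
  have e3 : damp h (damp d m) = damp d (damp h m) by rewrite -!dampD addrC.
  rewrite dampB damp_add e3; apply: dot_ext => w.
  move: (congr1 (dot^~ w) mv) (congr1 (dot^~ w) e1) (congr1 (dot^~ w) e2).
  rewrite !dotE; lra.
have uz : dot u (U d z) = 0.
  rewrite /u dot_slab slab_flow subrr sub0r /slab !future_id ?subrr ?flow_zero
    ?dot0r// ?oppr0 ?opprK ?flow0//.
  by apply: flow_sub => //; exact: ltW.
by rewrite {1}mu dotDl uz add0r /damp dotZl dot_flow.
Qed.

Lemma closed_shifted t : closed [set x | Ep (U (- t) x)].
Proof.
apply: closed_sqnP => v hv; apply: closed_sqn cEp _ => e e0.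
by have [u Eu uv] := hv e e0; exists (U (- t) u) => //; rewrite -flowB sqn_flow.
Qed.

Lemma shifted_submod t : submod_closed [in [set x | Ep (U (- t) x)]].
Proof.
split; first by apply/mem_set; rewrite /= flow_zero; exact: memsub0.
move=> c u v /set_mem/= Eu /set_mem/= Ev; apply/mem_set => /=.
by rewrite flow_linear; exact: memsubZD.
Qed.

Lemma proj_shifted t x : proj [set x | Ep (U (- t) x)] x = future t x.
Proof.
apply: proj_unique => [||//|y Ey];
  [exact: shifted_submod|exact: closed_shifted|exact: future_in|].
by rewrite dot_future future_id.
Qed.

Lemma future_min t x y : Ep (U (- t) y) -> sqn (x - future t x) <= sqn (x - y).
Proof.
move=> Ey; rewrite -proj_shifted; apply: proj_min => //;
  [exact: shifted_submod|exact: closed_shifted].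
Qed.

Lemma sqn_sub_future t x : sqn (x - future t x) = sqn x - sqn (future t x).
Proof. by rewrite sqnB -sqn_future; lra. Qed.

Lemma big_slab d n x : \sum_(j < n) slab (j%:R * d) (j.+1%:R * d) x =
  slab 0 (n%:R * d) x.
Proof.
elim: n => [|n IH]; first by rewrite big_ord0 mul0r /slab subrr.
by rewrite big_ord_recr /= IH /slab addrA subrK.
Qed.

Lemma big_sqn_slab d n c x : 0 <= d ->
  \sum_(j < n) sqn (slab (c + j%:R * d) (c + j.+1%:R * d) x) =
    sqn (slab c (c + n%:R * d) x).
Proof.
move=> d0; have le_c (l : nat) : c <= c + l%:R * d by rewrite lerDl mulr_ge0.
rewrite sqn_slab//; elim: n => [|n IH];
  first by rewrite big_ord0 mul0r addr0 subrr.
rewrite big_ord_recr /= IH sqn_slab; last by rewrite lerD2l ler_wpM2r// ler_nat.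
by rewrite addrA subrK.
Qed.

(** The approximation averages all cells of y, shifted back to the first one,
    and spreads the result. The error on cell j is the average over i of the
    j-th cell of y - damp ((j - i) d) y; convexity of the square and
    orthogonality of the cells bound its square norm by a sum over the shifts
    r - N, which contain all the j - i. *)
Lemma qper_approx d n y : 0 < d ->
  exists2 v, qper d n.+1 v &
    sqn (slab 0 (n.+1%:R * d) y - v) <= n.+1%:R^-1 *
      \sum_(r < n.+1.*2) sqn (slab 0 (n.+1%:R * d) (y -
        damp ((r%:R - n.+1%:R) * d) y)).
Proof.
move=> d0; set N := n.+1; pose q j := slab (j%:R * d) (j.+1%:R * d).
have N0 : 0 < N%:R :> R by rewrite ltr0n.
have qle (j : nat) : j%:R * d <= j.+1%:R * d by rewrite ler_pM2r// ler_nat.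
pose u := rscale N%:R^-1 (\sum_(i < N) damp (- (i%:R * d)) (q i y)).
have Qu : slab 0 d u = u.
  rewrite /u /rscale slabZ slab_sum; congr (_ *: _); apply: eq_bigr => i _.
  by rewrite slab_damp sub0r opprK {1}/q (_ : d + i%:R * d =
    i.+1%:R * d) ?slab_small// -natr1; ring.
exists (spread d N u).
  by rewrite /qper /= slab_spread// ltW.
pose G r := y - damp ((r%:R - N%:R) * d) y.
have -> : slab 0 (N%:R * d) y - spread d N u =
    \sum_(j < N) q j (rscale N%:R^-1 (\sum_(i < N) G (N + j - i)%N)).
  rewrite -big_slab /spread -sumrB; apply: eq_bigr => j _.
  have -> : damp (j%:R * d) u = rscale N%:R^-1
      (\sum_(i < N) q j (damp (((N + j - i)%N%:R - N%:R) * d) y)).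
    rewrite /u /rscale dampZ damp_sum; congr (_ *: _); apply: eq_bigr => i _.
    have iN : (i <= N + j)%N by rewrite (leq_trans (ltnW (ltn_ord i)))//
      leq_addr.
    rewrite -dampD /q slab_damp natrB// natrD.
    have -> : (N%:R + j%:R - i%:R - N%:R) * d = j%:R * d - i%:R * d by ring.
    congr (damp _ (slab _ _ y)); first by ring.
    by rewrite -!natr1; ring.
  have -> : slab (j%:R * d) (j.+1%:R * d) y =
    rscale N%:R^-1 (\sum_(i < N) q j y).
    rewrite sumr_const card_ord /rscale -[X in _ *: X]scaler_nat scalerA.
    have -> : (N%:R : R[i]) = (N%:R%:C)%C by rewrite rmorph_nat.
    by rewrite -rmorphM /= mulVf ?gt_eqF// scale1r.
  rewrite -rscaleBr -sumrB /rscale /q slabZ slab_sum; congr (_ *: _).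
  by apply: eq_bigr => i _; rewrite -slabB.
rewrite (@sqn_sum_orth _ _ N (fun j =>
  q j (rscale N%:R^-1 (\sum_(i < N) G (N + j - i)%N)))); last first.
  move=> i j ij; apply: slab_orth => //; by rewrite ler_pM2r// ler_nat.
have bd (j : 'I_N) : sqn (q j (rscale N%:R^-1 (\sum_(i <
  N) G (N + j - i)%N))) <=
    N%:R^-1 * \sum_(r < N.*2) sqn (q j (G r)).
  rewrite /q /rscale slabZ -rscaleE sqnZ slab_sum -/(q j).
  apply: (@le_trans _ _ (N%:R^-1 ^+ 2 * (N%:R * \sum_(i <
    N) sqn (q j (G (N + j - i)%N))))).
      by apply: ler_wpM2l; [exact: sqr_ge0|exact: (sqn_sum_le N (fun i =>
        q j (G (N + j - i)%N)))].
  have -> (S : R) : N%:R^-1 ^+ 2 * (N%:R * S) = N%:R^-1 * S by field;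
    rewrite gt_eqF.
  rewrite ler_wpM2l ?invr_ge0//.
  by apply: (@sum_window _ (fun r => sqn (q j (G r)))) => // r; exact: sqn_ge0.
apply: le_trans (ler_sum _ (fun j _ => bd j)) _.
rewrite -mulr_sumr ler_wpM2l ?invr_ge0// exchange_big /=.
apply: ler_sum => r _; rewrite -/(G r).
have := big_sqn_slab N 0 (G r) (ltW d0); rewrite add0r => <-.
by apply: ler_sum => j _; rewrite !add0r.
Qed.

Lemma damp_flow t s x : damp t (U s x) = U s (damp t x).
Proof. by rewrite /damp flow_rscale -!flowD addrC. Qed.

Section Totality.
Context (w : E) (wM : forall t m, expspace m -> dot w (U t m) = 0).

(** The term s k is the square norm of the projection of the slab of w onto
    the k-th quasi-periodic subspace; it tends to 0 because the slab is
    orthogonal to the intersection of these subspaces, as w is to the orbit of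
    [expspace]. *)
Lemma cell_bound h a : 0 < h ->
  exists s : nat -> R, s @ \oo --> 0 /\ forall k,
    sqn (slab a (a + h) w) <= s k + (2 ^ k)%:R^-1 *
      \sum_(r < (2 ^ k).*2)
        sqn (slab a (a + h) (w - damp ((r%:R - (2 ^ k)%:R) * (h / 2 ^+ k)) w)).
Proof.
move=> h0; pose y := U (- a) w; pose x := slab 0 h y.
have dk k : 0 < h / 2 ^+ k by rewrite divr_gt0// exprn_gt0.
have sN k := qper_submod (h / 2 ^+ k) (2 ^ k).
have cN k := @qper_closed (h / 2 ^+ k) (2 ^ k) (ltW (dk k)).
have xN v : (forall k, dyadic_qper h k v) -> dot x v = 0.
  move=> /(dyadic_qper_expspace h0)[Qv [m Mm mv]].
  rewrite /x dot_slab Qv /y dot_flowl opprK mv flowB dotBr wM// /damp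
    flow_rscale dotZr -flowD wM//.
  by rewrite mulr0 subrr.
exists (fun k => sqn (proj (dyadic_qper h k) x)); split.
  exact: (proj_nested_cvg0 sN cN (fun k => dyadic_qper_nested (k := k) h0) xN).
move=> k; set N := (2 ^ k)%N.
have Nd : N%:R * (h / 2 ^+ k) = h.
  by rewrite /N natrX mulrC divfK// expf_neq0.
have N0 : (0 < N)%N by rewrite expn_gt0.
have QE z : sqn (slab 0 h (U (- a) z)) = sqn (slab a (a + h) z).
  by rewrite slab_flow sqn_flow sub0r !opprK (addrC h).
have [v vN hv] := qper_approx N.-1 y (dk k).
rewrite prednK// Nd in vN hv.
have -> : sqn (slab a (a + h) w) = sqn x by rewrite /x /y QE.
have := sqn_sub_proj (sN k) (cN k) x; have := proj_min (sN k) (cN k) x vN.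
rewrite -/(dyadic_qper h k) => h1 h2.
have : sqn x <= sqn (proj (dyadic_qper h k) x) + sqn (x - v) by lra.
move/le_trans; apply; rewrite lerD2l; apply: le_trans hv _.
apply: ler_wpM2l; first by rewrite invr_ge0.
by apply: ler_sum => r _; rewrite /y damp_flow -flowB QE.
Qed.

(** Summing [cell_bound] over the cells reassembles the errors into full
    square norms, and the bound no longer depends on the window. *)
Lemma window_bound h n (e : R) : 0 < h ->
  (forall t, `|t| <= h -> sqn (w - damp t w) <= e) ->
  sqn (slab (- (n%:R * h)) (n%:R * h) w) <= 2 * e.
Proof.
move=> h0 we.
pose a j := - (n%:R * h) + j%:R * h.
have [s /all_and2[s0 hs]] := choice (fun j : nat => cell_bound (a j) h0).
have e0 : 0 <= e by apply: le_trans (we 0 _); rewrite ?sqn_ge0// normr0 ltW.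
have aS j : a j + h = - (n%:R * h) + j.+1%:R * h by rewrite /a -natr1; ring.
have nn : n%:R * h = - (n%:R * h) + n.*2%:R * h.
  by rewrite -mul2n natrM; ring.
have sumQ x : \sum_(j < n.*2) sqn (slab (a j) (a j + h) x) =
    sqn (slab (- (n%:R * h)) (n%:R * h) x).
  rewrite [X in _ = sqn (slab _ X _)]nn -big_sqn_slab ?ltW//;
    apply: eq_bigr => j _.
  by rewrite aS.
have bound k : sqn (slab (- (n%:R * h)) (n%:R * h) w) <=
  \sum_(j < n.*2) s j k + 2 * e.
  rewrite -sumQ; apply: le_trans (ler_sum _ (fun (j : 'I_n.*2) _ => hs j k)) _.
  rewrite big_split /= lerD2l -mulr_sumr exchange_big /=.
  set N := (2 ^ k)%N; have N0 : 0 < N%:R :> R by rewrite ltr0n expn_gt0.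
  rewrite mulrC ler_pdivrMr//.
  apply: (@le_trans _ _ (\sum_(r < N.*2) e)).
    apply: ler_sum => r _; rewrite sumQ; apply: le_trans (sqn_slab_le _ _) _.
      by rewrite ge0_cp// mulr_ge0// ltW.
    apply: we; rewrite normrM (ger0_norm (_ : 0 <= h / 2 ^+ k)); last first.
      by rewrite divr_ge0 ?exprn_ge0// ltW.
    have r1 : `|(r : nat)%:R - N%:R| <= N%:R :> R.
      rewrite ler_norml; apply/andP; split.
        by rewrite -subr_ge0 opprK subrK.
      rewrite lerBlDr -natrD ler_nat addnn; exact: ltnW (ltn_ord r).
    apply: le_trans (ler_wpM2r _ r1) _;
      first by rewrite divr_ge0 ?exprn_ge0// ltW.
    by rewrite /N natrX mulrC divfK// expf_neq0.
  by rewrite sumr_const card_ord -[leLHS]mulr_natr -mul2n natrM mulrA (mulrC e).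
have c0 : (fun k => \sum_(j < n.*2) s j k + 2 * e) @ \oo --> 2 * e.
  suff : forall l, (fun k => \sum_(j < l) s j k) @ \oo --> 0.
    have ce : (fun _ : nat => 2 * e) @ \oo --> 2 * e by exact: cvg_cst.
    by move=> H; have H2 := cvgD (H n.*2) ce; rewrite add0r in H2; exact: H2.
  elim=> [|l IH].
    have -> : (fun k => \sum_(j < 0) s j k) = cst 0.
      by apply/funext => k; rewrite big_ord0.
    exact: cvg_cst.
  have -> : (fun k => \sum_(j < l.+1) s j k) =
    (fun k => \sum_(j < l) s j k) \+ s l.
    by apply/funext => k; rewrite big_ord_recr.
  by have H := cvgD IH (s0 l); rewrite addr0 in H; exact: H.
apply: (ler_cvg_to (cvg_cst _) c0); exact: nearW.
Qed.

Context (LP2 : forall v, (forall t, 0 < t -> Ep (U (- t) v)) -> v = 0).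
Context (LP3 : forall v (e : R), 0 < e ->
  exists t z, Ep z /\ sqn (v - U t z) < e).

Lemma future_cvg0 h x : 0 < h -> (fun n =>
  sqn (future (n%:R * h) x)) @ \oo --> 0.
Proof.
move=> h0.
rewrite (_ : (fun n => _) = (fun n =>
  sqn (proj [set x | Ep (U (- (n%:R * h)) x)] x))); last first.
  by apply/funext => n; rewrite proj_shifted.
apply: proj_nested_cvg0.
- by move=> n; exact: shifted_submod.
- by move=> n; exact: closed_shifted.
- move=> n v /= Ev; rewrite (_ : - (n%:R * h) = h - n.+1%:R * h); last first.
    by rewrite -natr1; ring.
  by rewrite flowD; apply: flow_sub => //; exact: ltW.
- move=> v Ev; rewrite (LP2 (v := v)) ?dot0r// => t t0.
  pose n := (Num.truncn (t / h)).+1.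
  have tn : t <= n%:R * h.
    by rewrite -ler_pdivrMr// ltW// truncnS_gt.
  rewrite (_ : - t = (n%:R * h - t) - n%:R * h); last by ring.
  by rewrite flowD; apply: flow_sub; [rewrite subr_ge0|exact: Ev].
Qed.

Lemma past_cvg1 h x (e : R) : 0 < h -> 0 < e ->
  \forall n \near \oo, sqn x - sqn (future (- (n%:R * h)) x) < e.
Proof.
move=> h0 e0; have [t [z [Ez tz]]] := LP3 x e0.
exists (Num.truncn (- t / h)).+1 => // n /= nt.
rewrite -sqn_sub_future; apply: le_lt_trans (future_min _ _) tz.
rewrite opprK -flowD; apply: flow_sub => //.
have : - t / h <= n%:R.
  by rewrite ltW// (lt_le_trans (truncnS_gt _))// ler_nat.
rewrite ler_pdivrMr//; lra.
Qed.

Lemma expspace_total : w = 0.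
Proof.
apply/sqn_eq0/eqP; rewrite eq_le sqn_ge0 andbT.
apply/ler_addgt0Pl => e e0; rewrite addr0.
have e4 : 0 < e / 4 by lra.
have [d d0 hd] := damp_near w e4.
pose h := d / 2; have h0 : 0 < h by rewrite /h; lra.
have we t : `|t| <= h -> sqn (w - damp t w) <= e / 4.
  by move=> th; apply/ltW/hd; rewrite /h in th *; lra.
have [N1 _ hN1] := past_cvg1 w h0 e4.
move/cvgrPdist_lt : (future_cvg0 w h0) => /(_ _ e4)[N2 _ hN2].
pose n := maxn N1 N2.
have := window_bound n h0 we; rewrite sqn_slab; last first.
  by rewrite ge0_cp// mulr_ge0// ltW.
have := hN1 n (leq_maxl _ _); have := hN2 n (leq_maxr _ _) => /=.
rewrite sub0r normrN => /(le_lt_trans (ler_norm _)); lra.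
Qed.

End Totality.

End TranslationGroup.

(** * Outgoing subspaces from reflection positivity *)

Section Outgoing.
Context {R : realType} {E : hilbertType R} (Ep : set E) (theta : E -> E)
  (U : R -> E -> E).
Context (rE : reflection_positive_space Ep theta)
  (rU : reflection_positive_group Ep theta U) (cU : cyclic_subspace U Ep).

Let sEp : submod_closed [in Ep]. Proof. by have [_ _ + _ _] := rE; exact. Qed.
Let gU : unitary_one_parameter_group U. Proof. by have [] := rU. Qed.
Let Umono : forall t, 0 < t -> U t @` Ep `<=` Ep. Proof. by have [] := rU. Qed.

Lemma flow_sub_le s t z : s <= t -> Ep z -> exists2 y, Ep y & U t z = U s y.
Proof.
move=> st Ez; exists (U (t - s) z); last by rewrite -(flowD gU) addrC subrK.
by apply: (flow_sub gU Umono) => //; rewrite subr_ge0.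
Qed.

(** The translates of Ep form a chain, so that the union of those at negative
    times is already a subspace and contains the span of all translates. *)
Lemma dense_translates v (e : R) : 0 < e ->
  exists t z, [/\ t < 0, Ep z & sqn (v - U t z) < e].
Proof.
move=> e0.
pose A : set E := [set x | exists t z, [/\ t < 0, Ep z & x = U t z]].
have sA : Defs.subspace A.
  split; first by apply/mem_set; exists (-1), 0; rewrite ltrN10 (flow_zero gU);
    split=> //; exact: memsub0.
  move=> c x y /set_mem[t [z [t0 Ez ->]]] /set_mem[s [z' [s0 Ez' ->]]].
  apply/mem_set; pose r := Num.min t s.
  have rt : r <= t by rewrite ge_min lexx.
  have rs : r <= s by rewrite ge_min lexx orbT.
  have [y1 Ey1 ->] := flow_sub_le rt Ez; have [y2 Ey2 ->] := flow_sub_le rs Ez'.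
  exists r, (c *: y1 + y2); split; first by rewrite /r gt_min t0.
    exact: memsubZD.
  by rewrite (flow_linear gU).
have [u Au vu] := (dense_sqn _).1 cU v e e0.
have [t [z [t0 Ez uE]]] : A u.
  apply: Au; split=> // _ [t _ [z Ez <-]].
  have tm : Num.min t (-1) <= t by rewrite ge_min lexx.
  have [y Ey ->] := flow_sub_le tm Ez.
  by exists (Num.min t (-1)), y; split=> //; rewrite gt_min ltrN10 orbT.
by exists t, z; split=> //; rewrite -uE.
Qed.

(** An increment g s - g 0 > 0 would be reproduced at every step of length s,
    by convexity, and g would be unbounded. *)
Lemma bounded_convex_cst (g : R -> R) (C : R) : (forall t, `|g t| <= C) ->
  (forall s t, 0 <= g (t + s) + g (t - s) - 2 * g t) -> forall t, g t = g 0.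
Proof.
move=> gC gconv t.
have inc s (n : nat) : g s - g 0 <= g (n.+1%:R * s) - g (n%:R * s).
  elim: n => [|n IH]; first by rewrite mul1r mul0r.
  have := gconv s (n.+1%:R * s).
  have -> : n.+1%:R * s + s = n.+2%:R * s by rewrite -[n.+2%:R]natr1; ring.
  have -> : n.+1%:R * s - s = n%:R * s by rewrite -[n.+1%:R]natr1; ring.
  lra.
(* summing the increments along 0, s, ..., n s *)
have lin s (n : nat) : n%:R * (g s - g 0) <= 2 * C.
  have : n%:R * (g s - g 0) <= g (n%:R * s) - g 0.
    elim: n => [|n IH]; first by rewrite !mul0r subrr.
    have := inc s n; rewrite -[in X in X * _ <= _]natr1 mulrDl mul1r; lra.
  have := gC (n%:R * s); have := gC 0; rewrite !ler_norml; lra.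
have up s : g s <= g 0.
  rewrite leNgt; apply/negP => h.
  have h0 : 0 < g s - g 0 by rewrite subr_gt0.
  have := lin s (Num.truncn (2 * C / (g s - g 0))).+1.
  by rewrite leNgt -ltr_pdivrMr// truncnS_gt.
apply/eqP; rewrite eq_le up /=.
have := gconv t 0; rewrite add0r sub0r; have := up (- t); lra.
Qed.

Lemma theta_props :
  [/\ forall u v, theta (u - v) = theta u - theta v,
      forall u v, dot (theta u) (theta v) = dot u v,
      forall v, theta (theta v) = v &
      forall t v, theta (U t v) = U (- t) (theta v)].
Proof.
have [[lt it _] iv _ _ _] := rE; have [_ _ ut] := rU.
split=> [u v|u v||t v].
- by have := lt (-1) v u; rewrite !scaleN1r (addrC (- v)) (addrC (- theta v)).
- by rewrite /dot it.
- exact: iv.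
- by rewrite -ut iv.
Qed.

(** The form <theta x, y> is positive on Ep and <theta U_s x, U_r y> depends
    only on s + r. Hence the function t |-> <theta x, U_t x> has nonnegative
    second differences, is constant, and U_t v - v is null for the form. *)
Lemma invariant_fixed v : (forall t, Ep (U t v)) -> forall t, U t v = v.
Proof.
move=> Ev t.
have [thB dth thK thU] := theta_props.
have pos u : Ep u -> 0 <= dot (theta u) u.
  have [_ _ _ _ p] := rE; move=> /p; rewrite /dot lecE => /andP[_].
  by [].
have thC u w : dot (theta u) w = dot u (theta w) by rewrite -dth thK.
have shift s r x y : dot (theta (U s x)) (U r y) = dot (theta x) (U (s + r) y).
  by rewrite thU (dot_flowl gU) opprK -(flowD gU).
have gcst x : (forall t, Ep (U t x)) ->
  forall t, dot (theta x) (U t x) = dot (theta x) x.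
  move=> Ex r0.
  have -> : dot (theta x) x = dot (theta x) (U 0 x) by rewrite (flow0 gU).
  apply: (@bounded_convex_cst (fun t => dot (theta x) (U t x)) (sqn x)) =>
    [r|s r].
    rewrite -(@ler_pXn2r _ 2)// ?nnegrE ?normr_ge0 ?sqn_ge0// real_normK
      ?num_real//.
    apply: le_trans (dot_sq_le _ _) _.
    by rewrite (sqn_flow gU) /sqn dth expr2.
  have : Ep (U ((r + s) / 2) x - U ((r - s) / 2) x) by exact: memsubB.
  move=> /pos; rewrite thB !dotBl !dotBr !shift.
  have e1 : (r + s) / 2 + (r + s) / 2 = r + s by field.
  have e2 : (r - s) / 2 + (r - s) / 2 = r - s by field.
  have e3 : (r + s) / 2 + (r - s) / 2 = r by field.
  rewrite e1 e2 e3 (addrC ((r - s) / 2)) e3; lra.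
have null r : let x := U r v in
    forall y, Ep y -> dot (theta (U t x - x)) y = 0.
  move=> x y Ey.
  have Ex s : Ep (U s x) by rewrite /x -(flowD gU).
  clearbody x.
  set q := U t x - x.
  have Eq : Ep q by apply: memsubB => //; rewrite -[x](flow0 gU).
  have q0 : dot (theta q) q = 0.
    have e : dot (theta (U t x)) x = dot (theta x) (U t x).
      by have := shift t 0 x x; rewrite addr0 (flow0 gU).
    by rewrite /q thB !dotBl !dotBr e shift !gcst// subrr.
  (* positivity on y + a q, where the term in a^2 vanishes *)
  have h a : 0 <= dot (theta y) y + a * (2 * dot (theta q) y).
    have : Ep (y + rscale a q) by apply: memsubD => //; exact: memsubZ.
    move=> /pos; rewrite thC dotDl dotZl -!thC !dotDr !dotZr q0.
    by rewrite (thC y q) (dotC y) mulr0 addr0 => ?; lra.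
  apply/eqP; apply: contraT => nz.
  have := h (- (dot (theta y) y + 1) / (2 * dot (theta q) y)).
  rewrite divfK ?mulf_neq0//; lra.
pose q := U t v - v.
have orth r y : Ep y -> dot (theta q) (U r y) = 0.
  move=> /(null r) /=; rewrite -(flowD gU) (addrC t) (flowD gU) -(flowB gU) thU.
  by rewrite (dot_flowl gU) opprK.
apply/subr0_eq/sqn_eq0; rewrite -/q /sqn -dth -/(sqn _).
apply/eqP; rewrite eq_le sqn_ge0 andbT; apply/ler_addgt0Pl => e e0;
  rewrite addr0.
have [r [z [_ Ez rz]]] := dense_translates (theta q) e0.
move: rz; rewrite sqnB orth// mulr0 subr0; have := sqn_ge0 (U r z); lra.
Qed.

Lemma outgoing_LP2 : fixed_vectors U = [set 0] ->
  forall v, (forall t, 0 < t -> Ep (U (- t) v)) -> v = 0.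
Proof.
move=> fU v Ev.
suff : fixed_vectors U v by rewrite fU.
apply: invariant_fixed => t; have [t0|t0] := ltP t 0.
  by have := Ev (- t); rewrite opprK oppr_gt0; exact.
have -> : U t v = U (t + 1) (U (- 1) v) by rewrite -(flowD gU) addrK.
by apply: (flow_sub gU Umono); [lra|exact: Ev].
Qed.

Lemma outgoingP : fixed_vectors U = [set 0] -> outgoing U Ep.
Proof.
move=> fU; have [_ _ _ cEp _] := rE; split=> //.
  apply/seteqP; split=> [v Hv|_ ->] /=.
    apply: (outgoing_LP2 fU) => t t0; have [z Ez <-] := Hv t t0.
    by rewrite (flowNK gU).
  by move=> t _; exists 0; [exact: memsub0|exact: (flow_zero gU)].
apply/dense_sqn => v e e0; have [t [z [t0 Ez vz]]] := dense_translates v e0.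
by exists (U t z) => //; exists t => //; exists z.
Qed.

End Outgoing.

(** * Strongly measurable functions *)

Section StrongMeasurability.
Context {R : realType} {M : hilbertType R}.
Implicit Types (f : R -> M).

Lemma cvg_rnorm (u : nat -> M) l : u @ \oo --> l <->
  forall e : R, 0 < e -> \forall n \near \oo, rnorm (l - u n) < e.
Proof.
split=> [ul e e0|h].
  have e0' : 0 < (e%:C)%C by rewrite ltcR.
  move/cvgrPdist_lt : ul => /(_ _ e0'); apply: filterS => n.
  by rewrite -rnormE ltcR.
apply/cvgrPdist_lt => _ /gt0_complex[r r0 ->].
by have := h r r0; apply: filterS => n; rewrite -rnormE ltcR.
Qed.

(** The values of the approximating simple functions form a countable set. *)
Lemma sm_dense f : strongly_measurable f ->
  exists d : nat -> M, forall x (e : R), 0 < e ->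
    exists i, rnorm (f x - d i) < e.
Proof.
move=> [s ss sf].
have /choice[S hS] n : exists t : seq M, range (s n) = [set` t].
  by apply/finite_seqP; exact: (ss n).1.
exists (fun p => if unpickle p is Some (n, i) then nth 0 (S n) i else 0).
move=> x e e0; have /cvg_rnorm/(_ e e0)[N _ /(_ N (leqnn N)) hN] := sf x.
have : range (s N) (s N x) by exists x.
rewrite hS /= => sN; exists (pickle (N, index (s N x) (S N))).
by rewrite pickleK nth_index.
Qed.

(** The n-th simple function picks, among d 0, ..., d n, the first point
    closest to f x. *)
Lemma sm_closest f (d : nat -> M) :
  (forall i, measurable_fun [set: measurableTypeR R] (fun x =>
    rnorm (f x - d i))) ->
  (forall x (e : R), 0 < e -> exists i, rnorm (f x - d i) < e) ->
  strongly_measurable f.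
Proof.
move=> md dd.
pose r := fix r n x := if n is n'.+1 then Num.min (r n' x) (rnorm (f x - d n))
                       else rnorm (f x - d 0%N).
pose g := fix g n x := if n is n'.+1 then
    if rnorm (f x - d n) < r n' x then d n else g n' x else d 0%N.
have gr n x : rnorm (f x - g n x) = r n x.
  by elim: n => //= n IH; case: ltP.
have rle n x i : (i <= n)%N -> r n x <= rnorm (f x - d i).
  elim: n => [|n IH]; first by rewrite leqn0 => /eqP ->.
  rewrite leq_eqVlt ltnS /= ge_min => /orP[/eqP ->|/IH ->//].
  by rewrite lexx orbT.
have mr n : measurable_fun [set: measurableTypeR R] (r n).
  by elim: n => [|n IH]; [exact: md|exact: measurable_minr].
exists g => [n|x].
  elim: n => [|n IH]; first by split;
    [exact: finite_image_cst|move=> y; rewrite preimage_cst; case: ifP].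
  pose b x := rnorm (f x - d n.+1) < r n x.
  have sb : is_simple b.
    split; first exact: finite_finset.
    move=> y; rewrite -[X in measurable X]setTI.
    exact: (measurable_fun_ltr (md n.+1) (mr n)).
  exact: (simple_comp (fun p => if p.1 then d n.+1 else p.2) (simple_pair sb
    IH)).
apply/cvg_rnorm => e e0; have [i hi] := dd x e e0.
exists i => // n /= ni; rewrite gr; exact: le_lt_trans (rle n x i ni) hi.
Qed.

Lemma strongly_measurable_dist f a : strongly_measurable f ->
  measurable_fun [set: measurableTypeR R] (fun x => rnorm (f x - a)).
Proof.
move=> mf; apply: (strongly_measurable_rnorm (f := f \+ (fun=> - a))).
by apply: strongly_measurableD => //; exact: strongly_measurable_cst.
Qed.

Lemma strongly_measurable_cvg (f_ : nat -> R -> M) f :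
  (forall n, strongly_measurable (f_ n)) ->
  (forall x, f_ n x @[n --> \oo] --> f x) -> strongly_measurable f.
Proof.
move=> mf ff.
have /choice[d hd] n := sm_dense (mf n).
pose D p := if unpickle p is Some (n, i) then d n i else 0.
apply: (@sm_closest f D).
  move=> p; move: (D p) => a.
  apply: (measurable_fun_cvg (h := fun n x => rnorm (f_ n x - a))) => [n|x _].
    exact: strongly_measurable_dist.
  apply/cvgrPdist_lt => e e0; have /cvg_rnorm/(_ e e0) := ff x.
  apply: filterS => n; apply: le_lt_trans.
  apply: le_trans (rnorm_dist _ _) _.
  by rewrite opprB addrA subrK.
move=> x e e0; have e2 : 0 < e / 2 by lra.
have /cvg_rnorm/(_ _ e2)[N _ /(_ N (leqnn N)) hN] := ff x.
have [i hi] := hd N x _ e2; exists (pickle (N, i)); rewrite /D pickleK.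
rewrite -(subrK (f_ N x) (f x)) -addrA.
have : rnorm (f x - f_ N x + (f_ N x - d N i)) <=
    rnorm (f x - f_ N x) + rnorm (f_ N x - d N i).
  by rewrite -(@lecR R) rmorphD/= !rnormE ler_normD.
lra.
Qed.

Lemma strongly_measurable_restrict (A : set R) f : measurable A ->
  strongly_measurable f ->
  strongly_measurable (fun x => if x \in A then f x else 0).
Proof.
move=> mA [s ss sf].
exists (fun n x => if x \in A then s n x else 0) => [n|x]; last first.
  by case: ifP => _; [exact: sf|exact: cvg_cst].
have sA : is_simple (fun x => x \in A).
  split; first exact: finite_finset.
  case; [rewrite (_ : _ @^-1` _ = A)//|rewrite (_ : _ @^-1` _ = ~` A)].
  - by apply/seteqP; split=> [x /set_mem|x /mem_set].
  - exact: measurableC.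
  - apply/seteqP; split=> x /=; first by move=> Ax Ax'; move: Ax;
    rewrite (mem_set Ax').
    by move=> nA; apply/negbTE/negP => /set_mem.
exact: (simple_comp (fun p => if p.1 then p.2 else 0) (simple_pair sA (ss n))).
Qed.

Lemma rnorm_rscale a (m : M) : rnorm (rscale a m) = `|a| * rnorm m.
Proof. by rewrite rnormZ normc_def /= expr0n addr0 sqrtr_sqr. Qed.

Lemma strongly_measurable_scale (phi : R -> R) (m : M) :
  measurable_fun [set: measurableTypeR R] phi ->
  strongly_measurable (fun x => rscale (phi x) m).
Proof.
move=> mphi; pose q i : R := if unpickle i is Some r then ratr r else 0.
have rB a b : rscale a m - rscale b m = rscale (a - b) m.
  by rewrite /rscale rmorphB scalerBl.
apply: (@sm_closest _ (fun i => rscale (q i) m)) => [i|x e e0].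
  under eq_fun do rewrite rB rnorm_rscale.
  apply: measurable_funM => //; apply: measurableT_comp => //.
  exact: measurable_funB.
have m0 := rnorm_ge0 m.
have e1 : 0 < e / (rnorm m + 1) by rewrite divr_gt0//; lra.
have : phi x < phi x + e / (rnorm m + 1) by rewrite ltrDl.
move=> /rat_in_itvoo[r]; rewrite in_itv/= => /andP[r1 r2].
exists (pickle r); rewrite rB rnorm_rscale /q pickleK.
have h : `|phi x - ratr r| < e / (rnorm m + 1) by rewrite ltr_norml; lra.
rewrite ltr_pdivlMr in h; last by lra.
have := normr_ge0 (phi x - ratr r); nra.
Qed.

End StrongMeasurability.

(** * Exponential vectors in L2 *)

Section ScalarIntegrals.
Context {R : realType}.
Local Notation mu := (@lebesgue_measure R).

Lemma Rintegral_translate (t : R) (f : R -> R) :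
  mu.-integrable setT (EFin \o f) -> \int[mu]_x f (x - t) = \int[mu]_x f x.
Proof.
move=> fi; have fit := integrable_translate t fi.
have := @integral_pushforward _ _ _ _ R _ (measurable_translate t) mu setT
  (EFin \o f) (measurable_int _ fi) fit measurableT.
rewrite preimage_setT /Rintegral => <-.
congr fine; apply: eq_measure_integral => [|mt A mA _];
  first exact: measurable_translate.
exact: lebesgue_measure_translate.
Qed.

(** By Lebesgue differentiation f is almost everywhere the derivative of its
    integral over ]-oo, x], which is constant near every point of ]a, b[. *)
Lemma ae_zero_of_cst_primitive (f : R -> R) (a b c : R) :
  mu.-integrable setT (EFin \o f) ->
  (forall x, a <= x <= b -> \int[mu]_(y in `[x, +oo[) f y = c) ->
  {ae mu, forall x, a < x < b -> f x = 0}.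
Proof.
move=> fi fc.
have fiS A : measurable A -> mu.-integrable A (EFin \o f).
  by move=> mA; exact: (integrableS measurableT mA (@subsetT _ _) fi).
have lf : locally_integrable [set: R] f.
  split; [|exact: openT|].
    by apply/measurable_EFinP; exact: (measurable_int _ fi).
  move=> K _ cK; have mK : measurable K by exact: compact_measurable.
  by have /integrableP[_] := fiS K mK.
have := @FTC1Ny R f (fun y => fiS _ (measurable_itv _)) lf.
apply: filterS => x [_ <-] /andP[ax xb].
pose C := \int[mu]_y f y - c.
rewrite derive1E (@near_eq_derive _ _ _ _ (cst C)) ?derive_cst//.
have : x \in `]a, b[ by rewrite in_itv/= ax.
move=> /near_in_itvoo; apply: filterS => y; rewrite in_itv/= => /andP[ay yb].
rewrite /cst /C -(fc y) ?ltW//.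
rewrite -Rintegral_itv_obnd_cbnd; last exact: fiS.
have U : [set: R] = `]-oo, y] `|` `]y, +oo[.
  apply/seteqP; split=> z //= _; rewrite !in_itv/= andbT.
  by case: (leP z y); [left|right].
rewrite U Rintegral_setU ?addrK//; first by rewrite -U.
by apply/disj_setPLR => z /=; rewrite !in_itv/= andbT => zy; apply/negP;
  rewrite -leNgt.
Unshelve. all: by end_near. Qed.

(** The function e_t. Its square is the density of the exponential law with
    rate 1, shifted by t, so that it has norm 1 in L2. *)
Definition cexp (t x : R) : R := \1_(`[t,
  +oo[%classic) x * expR (- (x - t) / 2).

Lemma cexp_ge t x : t <= x -> cexp t x = expR (- (x - t) / 2).
Proof. by move=> tx; rewrite /cexp indicE mem_set ?mul1r//= in_itv/= tx. Qed.

Lemma cexp_lt t x : x < t -> cexp t x = 0.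
Proof.
by move=> xt; rewrite /cexp indicE memNset ?mul0r//= in_itv/= leNgt xt.
Qed.

Lemma measurable_cexp t : measurable_fun [set: measurableTypeR R] (cexp t).
Proof.
apply: measurable_funM; first exact: measurable_indic.
apply: measurableT_comp; first exact: measurable_expR.
apply: measurable_funM => //; apply: measurableT_comp => //.
exact: measurable_funB.
Qed.

Lemma cexp_mul s t x : s <= t ->
  cexp s x * cexp t x = expR (- (t - s) / 2) * exponential_pdf 1 (x - t).
Proof.
move=> st; have [xt|tx] := ltP x t.
  by rewrite (cexp_lt xt) lt0_exponential_pdf ?mulr0// subr_lt0.
rewrite !cexp_ge// ?(le_trans st)// exponential_pdfE ?subr_ge0//= mul1r -!expRD.
by congr expR; field.
Qed.

Lemma cexp_translate s t x : cexp s (x - t) = cexp (s + t) x.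
Proof.
have [xs|sx] := ltP (x - t) s.
  by rewrite !cexp_lt//; lra.
by rewrite !cexp_ge//; [congr expR; field|lra].
Qed.

Lemma cexp_ge_trans s t x : s <= t -> t <= x ->
  cexp s x = expR (- (t - s) / 2) * cexp t x.
Proof.
move=> st tx; rewrite !cexp_ge//; last by lra.
by rewrite -expRD; congr expR; field.
Qed.

Lemma integrable_pdf_translate t :
  mu.-integrable setT (EFin \o (fun x => exponential_pdf 1 (x - t))).
Proof.
apply: (@integrable_translate R t (EFin \o exponential_pdf 1)).
exact: integrable_exponential_pdf.
Qed.

Lemma integrable_cexp s t : mu.-integrable setT (EFin \o (fun x =>
  cexp s x * cexp t x)).
Proof.
wlog st : s t / s <= t => [wl|].
  have [st|/ltW st] := leP s t; first exact: wl.
  by rewrite (_ : (fun x => _) = (fun x => cexp t x * cexp s x));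
    [exact: wl|apply/funext => x; rewrite mulrC].
have := integrableZl measurableT (expR (- (t -
  s) / 2)) (integrable_pdf_translate t).
by apply: eq_integrable => // x _; rewrite /= cexp_mul.
Qed.

Lemma Rintegral_cexp s t : \int[mu]_x (cexp s x * cexp t x) =
  expR (- `|t - s| / 2).
Proof.
wlog st : s t / s <= t => [wl|].
  have [st|/ltW st] := leP s t; first exact: wl.
  by rewrite distrC -wl//; apply: eq_Rintegral => x _; rewrite mulrC.
under eq_Rintegral do rewrite cexp_mul//.
rewrite RintegralZl//; last exact: integrable_pdf_translate.
rewrite Rintegral_translate; last exact: integrable_exponential_pdf.
by rewrite /Rintegral integral_exponential_pdf// mulr1 ger0_norm// subr_ge0.
Qed.

End ScalarIntegrals.

Section L2Exp.
Context {R : realType} {M : hilbertType R}.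
Local Notation mu := (@lebesgue_measure R).
Implicit Types (f g : R -> M) (F G : L2 M) (m : M) (s t : R).

Lemma dot_L2E F G : dot F G = \int[mu]_x dot (F x) (G x).
Proof. by []. Qed.

Lemma integrable_dot f g : f \in @L2_pred R M -> g \in @L2_pred R M ->
  mu.-integrable setT (EFin \o (fun x => dot (f x) (g x))).
Proof. exact: integrable_Re_inner. Qed.

Lemma ae_dot_eq f g f' g' : f \in @L2_pred R M -> g \in @L2_pred R M ->
  f' \in @L2_pred R M -> g' \in @L2_pred R M ->
  {ae mu, forall x, f x = f' x} -> {ae mu, forall x, g x = g' x} ->
  \int[mu]_x dot (f x) (g x) = \int[mu]_x dot (f' x) (g' x).
Proof.
move=> fL gL fL' gL' ff gg; rewrite /Rintegral; congr fine;
  apply: ae_eq_integral => //.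
- exact: measurable_int (integrable_dot fL gL).
- exact: measurable_int (integrable_dot fL' gL').
- by move: ff gg; apply: filterS2 => x -> ->.
Qed.

Lemma dot_class F g : g \in @L2_pred R M ->
  dot F (L2class g) = \int[mu]_x dot (F x) (g x).
Proof.
move=> gL; rewrite dot_L2E; apply: ae_dot_eq; rewrite ?L2valP//.
  exact: aeW.
exact: L2classE.
Qed.

Lemma dot_class2 f g : f \in @L2_pred R M -> g \in @L2_pred R M ->
  dot (L2class f) (L2class g) = \int[mu]_x dot (f x) (g x).
Proof.
move=> fL gL; rewrite dot_L2E; apply: ae_dot_eq; rewrite ?L2valP//;
  exact: L2classE.
Qed.

Lemma L2class_lin (c : R[i]) f g : f \in @L2_pred R M -> g \in @L2_pred R M ->
  L2class (c *: f + g) = c *: L2class f + L2class g.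
Proof.
move=> fL gL; apply/L2_extP.
have h1 : {ae mu, forall x, L2class (c *: f + g) x = (c *: f + g) x}.
  by apply: L2classE; rewrite rpredD ?rpredZ.
have h2 := L2PE c (L2class f) (L2class g).
have h3 : {ae mu, forall x, L2class f x = f x /\ L2class g x = g x}.
  by move: (L2classE fL) (L2classE gL); apply: filterS2.
by move: h1 h2 h3; apply: filterS3 => x -> -> [-> ->].
Qed.

Definition expfun t m : R -> M := fun x => rscale (cexp t x) m.

Lemma expfun_L2 t m : expfun t m \in @L2_pred R M.
Proof.
apply/L2_predP; split.
  by apply: strongly_measurable_scale; exact: measurable_cexp.
have := integrableZl measurableT (rnorm m ^+ 2) (integrable_cexp t t).
apply: eq_integrable => // x _ /=;
  rewrite rnorm_rscale exprMn real_normK ?num_real//.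
by rewrite -EFinM mulrC expr2.
Qed.

(** The class of e_t (x) m. *)
Definition expvec t m : L2 M := L2class (expfun t m).

Lemma dot_expvec s t m m' :
  dot (expvec s m) (expvec t m') = expR (- `|t - s| / 2) * dot m m'.
Proof.
rewrite dot_class2 ?expfun_L2// mulrC -Rintegral_cexp -RintegralZl//;
  last exact: integrable_cexp.
by apply: eq_Rintegral => x _; rewrite /expfun dotZl dotZr; ring.
Qed.

Lemma expvec_lin t (c : R[i]) m m' :
  expvec t (c *: m + m') = c *: expvec t m + expvec t m'.
Proof.
rewrite -L2class_lin ?expfun_L2//; congr L2class; apply/funext => x.
by rewrite /expfun /rscale scalerDr scalerA mulrC -scalerA.
Qed.

Lemma L2translate_expvec s t m : L2translate s (expvec t m) = expvec (s + t) m.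
Proof.
rewrite L2translate_class ?expfun_L2//; congr L2class; apply/funext => x.
by rewrite /expfun cexp_translate addrC.
Qed.

Lemma dot_translate t F G : dot (L2translate t F) (L2translate t G) = dot F G.
Proof.
rewrite dot_class2; try by apply: L2_pred_translate; exact: L2valP.
apply: (@Rintegral_translate R t (fun x => dot (F x) (G x))).
exact: (integrable_dot (L2valP F) (L2valP G)).
Qed.

(** The values of F lie in the closure of a countable set d; off the countably
    many null sets attached to the d n, the vector F x is orthogonal to all of
    them, hence to itself. *)
Lemma ae_eq0_weak (F : L2 M) (J : set R) :
  (forall m, {ae mu, forall x, J x -> dot (F x) m = 0}) ->
  {ae mu, forall x, J x -> F x = 0}.
Proof.
move=> h; have /L2_predP[mF _] := L2valP F.
have [d hd] := sm_dense mF.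
have /ae_foralln : forall n, {ae mu, forall x, J x -> dot (F x) (d n) = 0}.
  by move=> n; exact: h.
apply: filterS => x Hx Jx; apply/sqn_eq0/eqP; rewrite eq_le sqn_ge0 andbT.
apply/ler_addgt0Pl => e e0; rewrite addr0.
have q0 : 0 < Num.sqrt e by rewrite sqrtr_gt0.
have [i hi] := hd x _ q0; move: hi;
  rewrite rnorm_sqn_lt// (sqr_sqrtr (ltW e0)) => /ltW.
by rewrite sqnB Hx// mulr0 subr0; apply: le_trans; rewrite lerDl sqn_ge0.
Qed.

(** The product e^{-t/2} <F, e_t (x) m> is the integral over [t, oo[ of
    e^{-x/2} <F x, m>, up to the factor due to normalizing at a. *)
Lemma expvec_window (F : L2 M) (a b : R) :
  (forall t m, a <= t <= b -> expR (- t / 2) * dot F (expvec t m) =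
    expR (- b / 2) * dot F (expvec b m)) ->
  {ae mu, forall x, a < x < b -> F x = 0}.
Proof.
move=> h; apply: (@ae_eq0_weak F [set x | a < x < b]) => m.
have fL := expfun_L2 a m.
pose f x := dot (F x) (expfun a m x).
have fi : mu.-integrable setT (EFin \o f) by apply: integrable_dot => //;
  exact: (L2valP F).
have : {ae mu, forall x, a < x < b -> f x = 0}.
  apply: (@ae_zero_of_cst_primitive _ _ _ _ (expR (a / 2) * (expR (- b / 2) *
    dot F (expvec b m))) fi).
  move=> t /andP[at_ tb]; rewrite -(h t) ?at_// mulrA -expRD dot_class
    ?expfun_L2//.
  have it := integrable_dot (L2valP F) (expfun_L2 t m).
  rewrite -RintegralZl// Rintegral_mkcond; apply: eq_Rintegral => x _.
  rewrite patchE; case: ifPn => [/set_mem|/negP].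
    rewrite /= in_itv/= andbT => tx;
      rewrite /f /expfun !dotZr (cexp_ge_trans at_ tx).
    by rewrite mulrA; congr (expR _ * _ * _); field.
  move=> nx; have xt : x < t.
    by rewrite ltNge; apply/negP => tx; apply: nx; apply/mem_set;
      rewrite /= in_itv/= tx.
  by rewrite /expfun cexp_lt// dotZr mul0r mulr0.
apply: filterS => x H /andP[ax xb]; have /eqP := H (introT andP (conj ax xb)).
rewrite /f /expfun dotZr cexp_ge ?ltW// mulf_eq0 gt_eqF ?expR_gt0//=.
by move=> /eqP.
Qed.

Lemma L2_ae0 F : {ae mu, forall x, F x = 0} -> F = 0.
Proof.
move=> F0; apply/sqn_eq0; rewrite /sqn dot_L2E.
rewrite (@ae_dot_eq F F (fun=> 0) (fun=> 0)) ?L2valP//; try exact: rpred0.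
rewrite (@eq_Rintegral _ _ _ _ _ (cst 0)) => [|x _]; last by rewrite dot0l.
by rewrite Rintegral_cst// mul0r.
Qed.

Lemma real_bounds (x : R) : exists n : nat, - n%:R < x < n%:R.
Proof.
exists (Num.truncn `|x|).+1; rewrite -ltr_norml; exact: truncnS_gt.
Qed.

Lemma L2_total F : (forall t m, dot F (expvec t m) = 0) -> F = 0.
Proof.
move=> h; apply: L2_ae0.
have : {ae mu, forall x, forall n : nat, - n%:R < x < n%:R -> F x = 0}.
  by apply: ae_foralln => n; apply: expvec_window => t m _; rewrite !h !mulr0.
by apply: filterS => x Hx; have [n hn] := real_bounds x; exact: Hx n hn.
Qed.

(** Membership in the half line space is a linear condition on inner products
    with exponential vectors, because e_t - e^{t/2} e_0 lives on [t, 0[ for t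
    <= 0. *)
Lemma L2halfP F : L2half R M F <-> forall t m, t <= 0 ->
  dot F (expvec t m) = expR (t / 2) * dot F (expvec 0 m).
Proof.
split=> [F0 t m t0|h].
  rewrite !dot_class ?expfun_L2//.
  rewrite -RintegralZl//; last exact: (integrable_dot (L2valP F) (expfun_L2 _
    _)).
  rewrite /Rintegral; congr fine; apply: ae_eq_integral => //.
  - exact: (measurable_int mu (integrable_dot (L2valP F) (expfun_L2 _ _))).
  - exact: (measurable_int mu (integrableZl measurableT (expR (t / 2))
      (integrable_dot (L2valP F) (expfun_L2 0 m)))).
  move: F0; apply: filterS => x Fx _; have [x0|x0] := ltP x 0.
    by rewrite Fx// !dot0l mulr0.
  rewrite /expfun !dotZr (cexp_ge_trans t0 x0); congr EFin.
  by rewrite sub0r opprK; ring.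
have : {ae mu, forall x, forall n : nat, - n%:R < x < 0 -> F x = 0}.
  apply: ae_foralln => n; apply: expvec_window => t m /andP[_ t0].
  by rewrite (h t)// mulrA -expRD; congr (expR _ * _); field.
move=> H; rewrite /L2half /=; move: H.
apply: filterS => x Hx x0; have [n /andP[hn _]] := real_bounds x.
by apply: (Hx n); rewrite hn.
Qed.

End L2Exp.

(** * The Riesz-Fischer theorem *)

Section RieszFischer.
Context {R : realType} {M : hilbertType R}.
Local Notation mu := (@lebesgue_measure R).

(** S is the sum of the series of the u n, finite almost everywhere by
    monotone convergence, and set to 0 where the series diverges. *)
Lemma ae_summable (u : nat -> R -> R) (K : R) : (forall n x, 0 <= u n x) ->
  (forall n, mu.-integrable setT (EFin \o u n)) ->
  (forall n, \sum_(i < n) \int[mu]_x u i x <= K) ->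
  exists S : R -> R, [/\ forall x, 0 <=
    S x, mu.-integrable setT (EFin \o S), \int[mu]_x S x <= K &
    {ae mu, forall x, forall n, u n x <= S x}].
Proof.
move=> u0 ui uK.
pose T x : \bar R := (\sum_(0 <= n <oo) (u n x)%:E)%E.
have mu_ n : measurable_fun setT (EFin \o u n) by exact: (measurable_int mu (ui
  n)).
have T0 x : (0 <= T x)%E by apply: nneseries_ge0 => n _ _; rewrite lee_fin.
have mT : measurable_fun setT T.
  apply: (@ge0_emeasurable_sum _ _ R setT (fun n x => (u n x)%:E) xpredT) =>
    [n x _ _|n _].
    by rewrite lee_fin.
  exact: mu_.
have TK : (\int[mu]_x T x <= K%:E)%E.
  rewrite (@integral_nneseries _ _ R mu _ measurableT (fun n x =>
    (u n x)%:E))//; last first.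
    by move=> n x _; rewrite lee_fin.
  apply: lime_le.
    apply: is_cvg_nneseries => n _ _; apply: integral_ge0 => x _;
      by rewrite lee_fin.
  apply: nearW => n; rewrite big_mkord.
  rewrite (eq_bigr (fun i : 'I_n => (\int[mu]_x u i x)%:E)) => [|i _].
    by rewrite sumEFin lee_fin; exact: uK.
  by rewrite /Rintegral fineK//; exact: integrable_fin_num (ui i).
have Ti : mu.-integrable setT T.
  apply/integrableP; split => //.
  under eq_integral do rewrite gee0_abs//.
  by apply: le_lt_trans TK _; rewrite ltry.
have Tfin := integrable_ae measurableT Ti.
have TS : {ae mu, forall x, T x = (fine (T x))%:E}.
  by move: Tfin; apply: filterS => x /(_ I)/fineK.
have mS : measurable_fun setT (EFin \o (fine \o T)).
  by apply/measurable_EFinP; exact: measurableT_comp.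
have Si : mu.-integrable setT (EFin \o (fine \o T)).
  apply: (le_integrable measurableT _ _ Ti) => // x _ /=.
  case: (T x) (T0 x) => [r| |] //= _.
  by rewrite leey.
exists (fine \o T); split=> //.
- by move=> x; exact: fine_ge0.
  rewrite /Rintegral (_ : (\int[mu]_x _)%E = (\int[mu]_x T x)%E).
    by rewrite -lee_fin fineK//; exact: integrable_fin_num Ti.
  apply: ae_eq_integral => //.
  by move: TS; apply: filterS => x Tx _; rewrite /= -Tx.
move: TS; apply: filterS => x Tx n; rewrite /= -lee_fin -Tx.
apply: le_trans (nneseries_lim_ge n.+1 _) => [|k _ _]; last by rewrite lee_fin.
rewrite big_nat_recr//= leeDr//; apply: sume_ge0 => k _; by rewrite lee_fin.
Qed.

Local Notation q := (4^-1 : R).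

Lemma q_pow n : q ^+ n = (2^-1 ^+ n) ^+ 2.
Proof. by rewrite -exprM mulnC exprM; congr (_ ^+ _); field. Qed.

(** Square norms decreasing like 4^{-n} mean norms decreasing like 2^{-n}; the
    increments are then summable. *)
Lemma geometric_cvg (f : nat -> M) (s : R) : 0 <= s ->
  (forall n, sqn (f n.+1 - f n) <= s * q ^+ n) ->
  exists l, forall n, sqn (l - f n) <= 16 * (s * q ^+ n).
Proof.
move=> s0 fs.
pose p : nat -> R := fun n => 2^-1 ^+ n.
have p0 n : 0 <= p n by rewrite exprn_ge0// invr_ge0.
have step n : rnorm (f n - f n.+1) <= Num.sqrt s * p n.
  rewrite -(@ler_pXn2r _ 2)// ?nnegrE ?rnorm_ge0 ?mulr_ge0 ?sqrtr_ge0//.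
  by rewrite -sqn_rnorm sqn_distC exprMn sqr_sqrtr// -q_pow.
have tri (a b c : M) : rnorm (a - c) <= rnorm (a - b) + rnorm (b - c).
  rewrite -(@lecR R) rmorphD/= !rnormE (_ : a - c =
    (a - b) + (b - c)) ?ler_normD//.
  by rewrite addrA subrK.
have chain n j : rnorm (f n - f (n + j)%N) <=
  2 * Num.sqrt s * (p n - p (n + j)%N).
  elim: j => [|j IH]; first by rewrite addn0 !subrr rnorm0 mulr0.
  apply: le_trans (tri _ (f (n + j)%N) _) _; rewrite addnS.
  have := step (n + j)%N; rewrite /p exprS -/(p (n + j)%N) -/(p n); lra.
have [l hl] : exists l, forall n, sqn (l - f n) <= 4 * (4 * s * q ^+ n).
  apply: complete_sqn.
    rewrite -(mulr0 (4 * s)); apply: cvgM; first exact: cvg_cst.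
    by apply: cvg_expr; rewrite ger0_norm ?invr_ge0// invf_lt1// ltr1n.
  move=> n m /subnKC <-; rewrite sqn_rnorm q_pow -/(p n).
  have -> : 4 * s * p n ^+ 2 = (2 * Num.sqrt s * p n) ^+ 2.
    by rewrite !exprMn sqr_sqrtr//; congr (_ * _ * _); rewrite expr2; field.
  rewrite ler_pXn2r// ?nnegrE ?rnorm_ge0 ?mulr_ge0 ?sqrtr_ge0//.
  apply: le_trans (chain _ _) _.
  by apply: ler_wpM2l; [rewrite mulr_ge0 ?sqrtr_ge0|rewrite gerBl].
exists l => n; apply: le_trans (hl n) _; lra.
Qed.

Lemma L2class_repr (F : L2 M) : L2class (F : R -> M) = F.
Proof. by apply/L2_extP; apply: L2classE; exact: L2valP. Qed.

Lemma sqn_class_sub (f g : R -> M) : f \in @L2_pred R M -> g \in @L2_pred R M ->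
  sqn (L2class f - L2class g) = \int[mu]_x sqn (f x - g x).
Proof.
move=> fL gL.
have -> : L2class f - L2class g = L2class ((-1) *: g + f).
  by rewrite L2class_lin// scaleN1r addrC.
have hL : (-1) *: g + f \in @L2_pred R M by rewrite rpredD ?rpredZ.
rewrite /sqn dot_class2//; apply: eq_Rintegral => x _.
have -> : ((-1) *: g + f) x = f x - g x.
  by rewrite -[(-1 *: _ + f) x]/((-1) *: g x + f x) scaleN1r addrC.
by [].
Qed.

(** The increments have L2 norm at most 4^{-n}, so that the sum S of 4^n times
    their squares is integrable. Where S is finite the increments are
    dominated by a geometric sequence, hence the sequence converges, with an
    error bounded by a multiple of 4^{-n} S; integrating this bound gives the
    rate in L2. *)
Lemma riesz_fischer (F_ : nat -> L2 M) :
  (forall n, sqn (F_ n.+1 - F_ n) <= (q ^+ n) ^+ 2) ->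
  exists F, forall n, sqn (F - F_ n) <= 32 * q ^+ n.
Proof.
move=> hF.
have q0 n : 0 < q ^+ n by rewrite exprn_gt0.
pose D n x := sqn (F_ n.+1 x - F_ n x).
have Dint n : mu.-integrable setT (EFin \o D n) /\ \int[mu]_x D n x <=
  (q ^+ n) ^+ 2.
  split; last by rewrite -sqn_class_sub ?L2valP// !L2class_repr.
  have hL : (F_ n.+1 : R -> M) - (F_ n : R -> M) \in @L2_pred R M.
    by rewrite rpredB// L2valP.
  exact: (integrable_dot hL hL).
pose u n x := (q ^+ n)^-1 * D n x.
have ui n : mu.-integrable setT (EFin \o u n).
  exact: (integrableZl measurableT (q ^+ n)^-1 (Dint n).1).
have [S [S0 Si SK uS]] : exists S : R ->
  R, [/\ forall x, 0 <= S x, mu.-integrable setT (EFin \o S), \int[mu]_x S x <=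
    2 &
    {ae mu, forall x, forall n, u n x <= S x}].
  apply: ae_summable => // [n x|n].
    by rewrite mulr_ge0 ?invr_ge0 ?sqn_ge0// ltW.
  have : \sum_(i < n) \int[mu]_x u i x <= 2 * (1 - q ^+ n).
    elim: n => [|n IH]; first by rewrite big_ord0 expr0 subrr mulr0.
    rewrite big_ord_recr /= (RintegralZl _ measurableT (Dint n).1).
    have : (q ^+ n)^-1 * \int[mu]_x D n x <= q ^+ n.
      rewrite mulrC ler_pdivrMr// -expr2; exact: (Dint n).2.
    by rewrite exprS; have := q0 n; lra.
  by have := q0 n; lra.
move: uS => [N [mN N0 NS]].
have good x : x \in ~` N -> forall n, u n x <= S x.
  by move=> /set_mem xN n; apply: contrapT => h; apply: xN; apply: NS => /=;
    apply/existsNP; exists n.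
pose f n x := if x \in ~` N then F_ n x else 0.
have fcv x : exists l, (forall n, sqn (l - f n x) <= 16 * (S x * q ^+ n)) /\
    f n x @[n --> \oo] --> l.
  rewrite /f; have [xN|xN] := boolP (x \in ~` N); last first.
    exists 0; split=> [n|]; last exact: cvg_cst.
    by rewrite subrr sqn0 !mulr_ge0// ltW.
  have [l hl] : exists l, forall n, sqn (l - F_ n x) <= 16 * (S x * q ^+ n).
    apply: geometric_cvg => // n.
    by have := good x xN n; rewrite /u mulrC ler_pdivrMr.
  exists l; split=> // ; apply/cvg_rnorm => e e0.
  have c0 : (fun n => 16 * (S x * q ^+ n)) @ \oo --> 0.
    rewrite -(mulr0 16) -[X in 16 * X](mulr0 (S x)); apply: cvgM;
      first exact: cvg_cst.
    apply: cvgM; first exact: cvg_cst.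
    by apply: cvg_expr; rewrite ger0_norm ?invr_ge0// invf_lt1// ltr1n.
  have e2 : 0 < e ^+ 2 by rewrite exprn_gt0.
  move/cvgrPdist_lt : c0 => /(_ _ e2); apply: filterS => n.
  rewrite sub0r normrN => /(le_lt_trans (ler_norm _)) h.
  by rewrite rnorm_sqn_lt//; apply: le_lt_trans (hl n) h.
have /choice[g hg] := fcv.
have mg : strongly_measurable g.
  apply: (strongly_measurable_cvg (f_ := f)) => [n|x]; last by have [] := hg x.
  apply: strongly_measurable_restrict; first exact: measurableC.
  by have /L2_predP[] := L2valP (F_ n).
have fL n : f n \in @L2_pred R M.
  have /L2_predP[mF iF] := L2valP (F_ n).
  have mf : strongly_measurable (f n).
    by apply: strongly_measurable_restrict => //; exact: measurableC.
  apply/L2_predP; split=> //; apply: (le_integrable measurableT _ _ iF).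
    by apply/measurable_EFinP; apply: measurable_funX;
      exact: strongly_measurable_rnorm.
  move=> x _; rewrite /= lee_fin !ger0_norm ?sqr_ge0// /f.
  by case: ifP => // _; rewrite rnorm0 expr0n sqr_ge0.
have hint n : mu.-integrable setT (EFin \o (fun x => 16 * q ^+ n * S x)).
  exact: (integrableZl measurableT (16 * q ^+ n) Si).
have gf n x : sqn (g x - f n x) <= 16 * q ^+ n * S x.
  by have := (hg x).1 n; rewrite (mulrC (S x)) mulrA.
have gfL n : g - f n \in @L2_pred R M.
  have /L2_predP[mf _] := fL n.
  have mgf : strongly_measurable (g - f n).
    apply: strongly_measurableD => //.
    by have := strongly_measurableZ (-1) mf; rewrite (_ : _ \*: _ = - f n)//;
      apply/funext => x; exact: scaleN1r.
  apply/L2_predP; split=> //; apply: (le_integrable measurableT _ _ (hint n)).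
    by apply/measurable_EFinP; apply: measurable_funX;
      exact: strongly_measurable_rnorm.
  move=> x _; rewrite /= lee_fin -sqn_rnorm !ger0_norm ?sqn_ge0//;
    first exact: gf.
  by apply: le_trans (gf n x); exact: sqn_ge0.
have gL : g \in @L2_pred R M.
  by rewrite -(subrK (f 0%N) g) rpredD.
exists (L2class g) => n.
have -> : F_ n = L2class (f n).
  rewrite -[LHS]L2class_repr; apply/L2_extP.
  have aeN : {ae mu, forall x, f n x = F_ n x}.
    exists N; split=> // x /=; apply: contra_notP => xN.
    by rewrite /f mem_set.
  rewrite L2class_repr; move: aeN (L2classE (fL n)).
  by apply: filterS2 => x -> ->.
rewrite sqn_class_sub//.
apply: (@le_trans _ _ (\int[mu]_x (16 * q ^+ n * S x))).
  by apply: le_Rintegral => //; exact: (integrable_dot (gfL n) (gfL n)).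
rewrite RintegralZl//; have := q0 n;
  have : 0 <= 16 * q ^+ n by rewrite mulr_ge0// ltW.
move=> h0 _; apply: le_trans (ler_wpM2l h0 SK) _; lra.
Qed.

End RieszFischer.

(** * Closed subspaces as Hilbert spaces *)

(** Bundling the two proofs with the set lets [subHilbert] depend on them, as
    the inference of its structures requires. *)
Record closedSubspace (R : realType) (E : hilbertType R) := ClosedSubspace {
  cs_set :> set E; cs_subspace : Defs.subspace cs_set;
    cs_closed : closed cs_set }.

Section ClosedSubspaceHilbert.
Context {R : realType} {E : hilbertType R} (S : closedSubspace E).

Definition cs_pred : {pred E} := [in (S : set E)].

Fact cs_submod_closed : submod_closed cs_pred.
Proof. exact: (cs_subspace S). Qed.

HB.instance Definition _ := GRing.isSubmodClosed.Build _ _ cs_pred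
  cs_submod_closed.

Record subHilbert := SubHilbert { shval :> E; shvalP : shval \in cs_pred }.

HB.instance Definition _ := [isSub for shval].
HB.instance Definition _ := [Choice of subHilbert by <:].
HB.instance Definition _ := [SubChoice_isSubLmodule of subHilbert by <:].

Let shnorm (x : subHilbert) : R[i] := `|shval x|.

Fact shnormD x y : shnorm (x + y) <= shnorm x + shnorm y.
Proof. exact: ler_normD. Qed.
Fact shnormZ a x : shnorm (a *: x) = `|a| * shnorm x.
Proof. exact: normrZ. Qed.
Fact shnorm0 x : shnorm x = 0 -> x = 0.
Proof. by move=> /normr0_eq0 x0; apply: val_inj. Qed.

HB.instance Definition _ := @Lmodule_isNormed.Build R[i] subHilbert
  shnorm shnormD shnormZ shnorm0.

Definition shinner (x y : subHilbert) : R[i] := inner (shval x) (shval y).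

Fact shinnerC x y : shinner x y = (-1) ^+ false * (shinner y x)^*.
Proof. by rewrite mul1r /shinner conj_inner. Qed.

Fact shinner_bilinear : bilinear_for *%R (Num.conj \; *%R) shinner.
Proof.
split=> [z|z] a x y; rewrite /shinner /=.
  by rewrite linearPl.
by rewrite linearPr.
Qed.

Fact shinner_gt0 x : x != 0 -> 0 < shinner x x.
Proof.
move=> x0; rewrite /shinner innerE ltcR exprn_gt0// lt_neqAle rnorm_ge0 andbT.
by apply: contra x0 => /eqP/esym/rnorm_eq0 x0; apply/eqP/val_inj.
Qed.

HB.instance Definition _ := bilinear_isBilinear.Build R[i] subHilbert subHilbert
  R[i] _ _ shinner shinner_bilinear.
HB.instance Definition _ := isHermitianSesquilinear.Build R[i] subHilbert false
  Num.conj shinner shinnerC.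
HB.instance Definition _ := isDotProduct.Build R[i] subHilbert shinner
  shinner_gt0.
HB.instance Definition _ := isPreHilbert.Build R subHilbert shinner.

Fact sh_complete (F : set_system subHilbert) :
  ProperFilter F -> cauchy F -> cvg F.
Proof.
move=> PF /cauchyP cF.
have /cauchy_cvg/cvg_ex[/= l Fl] : cauchy (shval @ F).
  apply/cauchyP => e e0; have [x Fx] := cF e e0; exists (shval x).
  by rewrite /nbhs/=; move: Fx; apply: filterS => y; rewrite -!ball_normE.
have Sl : (S : set E) l.
  apply: (@cs_closed _ _ S) => B /Fl FB.
  have [x Bx] := @filter_ex _ F _ _ FB; exists (shval x).
  by split=> //; apply/set_mem; exact: shvalP.
apply/cvg_ex; exists (SubHilbert (mem_set Sl)).
apply/cvg_ballP => e e0.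
have /cvg_ballP/(_ _ e0) := Fl.
by apply: filterS => y; rewrite -!ball_normE.
Qed.

HB.instance Definition _ := Uniform_isComplete.Build subHilbert sh_complete.

Fact sh_inner_normE (x : subHilbert) : inner x x = `|x| ^+ 2.
Proof. exact: (inner_normE (shval x)). Qed.

HB.instance Definition _ := isHilbert.Build R subHilbert sh_inner_normE.
End ClosedSubspaceHilbert.

(** * Isometries and the real inner product *)

Section Generic.
Context {R : realType}.

Lemma inner_dotE (H : preHilbertType R) (u v : H) :
  inner u v = (dot u v +i* dot u ('i%C *: v))%C.
Proof. by rewrite -Im_dot /dot; case: (inner u v). Qed.

Lemma unitary_of_dot (H K : preHilbertType R) (V : H -> K) :
  (forall c u v, V (c *: u + v) = c *: V u + V v) ->
  (forall u v, dot (V u) (V v) = dot u v) ->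
  (forall y, exists x, V x = y) -> unitary V.
Proof.
move=> linV isoV ontoV; split=> [||]; first exact: linV.
  move=> u v; apply: etrans (inner_dotE (V u) (V v)) _.
  apply: etrans (esym (inner_dotE u v)); rewrite isoV; congr (_ +i* _)%C.
  have := linV 'i%C v (- 0); rewrite oppr0.
  have V0 : V 0 = 0.
    by apply: sqn_eq0; rewrite /sqn isoV dot0l.
  by rewrite V0 !addr0 => <-.
by apply/seteqP; split=> // y _; have [x <-] := ontoV y; exists x.
Qed.

Lemma unitary_dot (H K : preHilbertType R) (V : H -> K) : unitary V ->
  [/\ forall c u v, V (c *: u + v) = c *: V u + V v,
      forall u v, dot (V u) (V v) = dot u v &
      forall y, exists x, V x = y].
Proof.
move=> [linV isoV ontoV]; split=> [c u v|u v|y]; first exact: linV.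
  by rewrite /dot isoV.
have : setT y by []; rewrite -ontoV => -[x _ <-]; by exists x.
Qed.

Lemma isometry_inj (H K : preHilbertType R) (V : H -> K) :
  (forall c u v, V (c *: u + v) = c *: V u + V v) ->
  (forall u v, dot (V u) (V v) = dot u v) -> injective V.
Proof.
move=> linV isoV u v uv; apply/subr0_eq/sqn_eq0.
have VB : V (u - v) = V u - V v by rewrite addrC -scaleN1r linV scaleN1r addrC.
by rewrite /sqn -isoV VB uv subrr dot0l.
Qed.

Lemma dot_isometry (H K : preHilbertType R) (V : H -> K) :
  (forall c u v, V (c *: u + v) = c *: V u + V v) ->
  (forall u, sqn (V u) = sqn u) -> forall u v, dot (V u) (V v) = dot u v.
Proof.
move=> linV isoV u v.
have VD : V (u + v) = V u + V v by rewrite -[u in LHS]scale1r linV scale1r.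
by have := isoV (u + v); rewrite VD !sqnD !isoV; lra.
Qed.

Lemma L2_ext (M : hilbertType R) (F G : L2 M) :
  (forall t m, dot F (expvec t m) = dot G (expvec t m)) -> F = G.
Proof.
by move=> h; apply/subr0_eq/L2_total => t m; rewrite dotBl h subrr.
Qed.

Lemma sqn_expvec (M : hilbertType R) t (m : M) : sqn (expvec t m) = sqn m.
Proof. by rewrite /sqn dot_expvec subrr normr0 oppr0 mul0r expR0 mul1r. Qed.

Lemma expvec0 (M : hilbertType R) t : expvec t (0 : M) = 0.
Proof. by apply: sqn_eq0; rewrite sqn_expvec sqn0. Qed.

Lemma expvecZ (M : hilbertType R) t c (m : M) :
  expvec t (c *: m) = c *: expvec t m.
Proof. by rewrite -[c *: m in LHS]addr0 expvec_lin expvec0 addr0. Qed.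

Lemma expvec_inj (M : hilbertType R) t : injective (@expvec R M t).
Proof.
move=> m m' e; apply/subr0_eq/sqn_eq0.
have -> : m - m' = (-1) *: m' + m by rewrite scaleN1r addrC.
by rewrite -(sqn_expvec t) expvec_lin e scaleN1r addNr sqn0.
Qed.

Lemma small_geometric (a C : R) :
  (forall n, a ^+ 2 <= C * (4^-1) ^+ n) -> a = 0.
Proof.
move=> h; apply/eqP; rewrite -(sqrf_eq0 a) eq_le sqr_ge0 andbT.
have c0 : (fun n => C * (4^-1) ^+ n) @ \oo --> 0.
  rewrite -(mulr0 C); apply: cvgM; first exact: cvg_cst.
  by apply: cvg_expr; rewrite ger0_norm ?invr_ge0// invf_lt1// ltr1n.
by apply: (ler_cvg_to (cvg_cst _) c0); apply: nearW => n; exact: h.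
Qed.

End Generic.

(** * Existence of the outgoing realization *)

Section Existence.
Context {R : realType} {E : hilbertType R} (Ep : set E) (U : R -> E -> E).
Context (sEp : submod_closed [in Ep]) (cEp : closed Ep).
Context (gU : unitary_one_parameter_group U).
Context (Umono : forall t, 0 < t -> U t @` Ep `<=` Ep).
Context (LP2 : forall v, (forall t, 0 < t -> Ep (U (- t) v)) -> v = 0).
Context (LP3 : forall v (e : R), 0 < e ->
  exists t z, Ep z /\ sqn (v - U t z) < e).

(** The multiplicity space. *)
Definition mult_space : closedSubspace E :=
  ClosedSubspace (expspace_submod sEp gU) (expspace_closed cEp gU).
Local Notation M := (subHilbert mult_space).

Lemma shval_expspace (m : M) : expspace Ep U (shval m).
Proof. exact/set_mem/shvalP. Qed.

(** Finite combinations are indexed by lists of pairs (t, m), which makes the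
    correspondence with [model_sum] explicit. *)
Definition orbit_sum (l : seq (R * M)) : E := \sum_(p <- l) U p.1 (shval p.2).
Definition model_sum (l : seq (R * M)) : L2 M := \sum_(p <- l) expvec p.1 p.2.

Lemma dot_sums l l' :
  dot (model_sum l) (model_sum l') = dot (orbit_sum l) (orbit_sum l').
Proof.
rewrite /model_sum /orbit_sum !dot_suml; apply: eq_bigr => p _.
rewrite !dot_sumr; apply: eq_bigr => p' _.
rewrite dot_expvec; apply/esym.
exact: (dot_expspace gU _ _ (shval_expspace _) (shval_expspace _)).
Qed.

Lemma sqn_sub_sums l l' :
  sqn (model_sum l - model_sum l') = sqn (orbit_sum l - orbit_sum l').
Proof. by rewrite !sqnB /sqn !dot_sums. Qed.

Lemma orbit_sum1 t m : orbit_sum [:: (t, m)] = U t (shval m).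
Proof. by rewrite /orbit_sum big_seq1. Qed.
Lemma model_sum1 t m : model_sum [:: (t, m)] = expvec t m.
Proof. by rewrite /model_sum big_seq1. Qed.

Lemma orbit_sum_dense v (e : R) : 0 < e -> exists l, sqn (v - orbit_sum l) < e.
Proof.
move=> e0.
have sA : submod_closed [in range orbit_sum].
  split=> [|c _ _ /set_mem[l _ <-] /set_mem[l' _ <-]]; apply/mem_set.
    by exists [::] => //; rewrite /orbit_sum big_nil.
  exists ([seq (p.1, c *: p.2) | p <- l] ++ l') => //.
  rewrite /orbit_sum big_cat big_map /= scaler_sumr; congr (_ + _).
  by apply: eq_bigr => p _; rewrite -(flowZ gU).
have [w wA|_ [l _ <-] h] := dense_of_total sA _ v e0; last by exists l.
apply: (expspace_total sEp cEp gU Umono) LP2 LP3 => t m Mm.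
by apply: wA; exists [:: (t, @SubHilbert _ _ mult_space m (mem_set Mm))] => //;
  rewrite orbit_sum1.
Qed.

(** The function F is the Riesz-Fischer limit of the model sums of a fast
    approximation of v by orbit sums. Inner products with a fixed orbit sum
    and with v itself pass to the limit by the same argument, [main] below. *)
Lemma model_exists v : exists F : L2 M,
  (forall t m, dot F (expvec t m) = dot v (U t (shval m))) /\ sqn F = sqn v.
Proof.
pose q : R := 4^-1.
have q0 n : 0 < q ^+ n by rewrite exprn_gt0// invr_gt0.
have q1 n : q ^+ n <= 1 by rewrite exprn_ile1// ?invr_ge0// invf_le1// ler1n.
have /choice[l hl] n : exists l, sqn (v - orbit_sum l) < (q ^+ n) ^+ 2 / 4.
  by apply: orbit_sum_dense; rewrite divr_gt0// exprn_gt0.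
have qS n : (q ^+ n.+1) ^+ 2 <= (q ^+ n) ^+ 2.
  apply: lerXn2r; rewrite ?nnegrE; try exact: (ltW (q0 _)).
  rewrite exprS; apply: ler_piMl; first exact: (ltW (q0 _)).
  by rewrite /q invf_le1// ler1n.
have hl' n : sqn (v - orbit_sum (l n)) <= q ^+ n.
  apply: ltW; apply: lt_le_trans (hl n) _.
  move: (q0 n) (q1 n); move: (q ^+ n) => Q Q0 Q1; nra.
have [F hF] : exists F : L2 M, forall n, sqn (F - model_sum (l n)) <=
  32 * q ^+ n.
  apply: riesz_fischer => n; rewrite sqn_sub_sums.
  have -> : orbit_sum (l n.+1) - orbit_sum (l n) =
      (v - orbit_sum (l n)) - (v - orbit_sum (l n.+1)).
    by rewrite opprB [RHS]addrC addrA subrK.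
  apply: le_trans (sqnD_le _ _) _; rewrite sqnN.
  by have := hl n; have := hl n.+1; have := qS n; lra.
have main G u : (forall n, dot (model_sum (l n)) G = dot (orbit_sum (l n)) u) ->
    dot F G = dot v u.
  move=> h; apply/subr0_eq; apply: (@small_geometric _ _ (64 * sqn G +
    2 * sqn u)) => n.
  have -> : dot F G - dot v u =
      dot (F - model_sum (l n)) G - dot (v - orbit_sum (l n)) u.
    by rewrite !dotBl h; ring.
  have h1 := dot_sq_le (F - model_sum (l n)) G.
  have h2 := dot_sq_le (v - orbit_sum (l n)) u.
  have h3 : sqn (F - model_sum (l n)) * sqn G <= 32 * q ^+ n * sqn G.
    by apply: ler_wpM2r (hF n); exact: sqn_ge0.
  have h4 : sqn (v - orbit_sum (l n)) * sqn u <= q ^+ n * sqn u.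
    by apply: ler_wpM2r (hl' n); exact: sqn_ge0.
  have := sqr_ge0 (dot (F - model_sum (l n)) G + dot (v - orbit_sum (l n)) u).
  rewrite -/q; move: h1 h2 h3 h4.
  move: (sqn _ * sqn G) (sqn _ * sqn u) => A B.
  move: (dot _ G) (dot _ u) (sqn G) (sqn u) (q ^+ n) =>
    a b g r Q h1 h2 h3 h4 h5.
  have -> : (a - b) ^+ 2 = 2 * a ^+ 2 + 2 * b ^+ 2 - (a + b) ^+ 2 by ring.
  have -> : (64 * g + 2 * r) * Q = 2 * (32 * Q * g) + 2 * (Q * r) by ring.
  lra.
have tests k : dot F (model_sum k) = dot v (orbit_sum k).
  by apply: main => n; rewrite dot_sums.
exists F; split=> [t m|]; first by rewrite -model_sum1 tests orbit_sum1.
apply: main => n.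
by rewrite dotC tests dotC.
Qed.

(** All properties of Phi follow from its defining inner products with the
    exponential vectors and from totality. It is onto since its range contains
    all exponential vectors and F minus its projection is orthogonal to the
    range. *)
Lemma outgoing_realization_exists :
  exists (N : hilbertType R) (Phi : E -> L2 N), outgoing_realization U Ep Phi.
Proof.
have /choice[Phi hPhi] := model_exists.
have PhiE v t m : dot (Phi v) (expvec t m) = dot v (U t (shval m)).
  by have [] := hPhi v.
have PhiS v : sqn (Phi v) = sqn v by have [] := hPhi v.
have linPhi c u v : Phi (c *: u + v) = c *: Phi u + Phi v.
  apply: L2_ext => t m; rewrite PhiE !dotDl !dotZcl PhiE -expvecZ PhiE.
  by rewrite -(flowZ gU).
have isoPhi := dot_isometry linPhi PhiS.
have Phi_exp t (m : M) : Phi (U t (shval m)) = expvec t m.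
  apply: L2_ext => s m'; rewrite PhiE dot_expvec.
  by rewrite (dot_expspace gU _ _ (shval_expspace m) (shval_expspace m')).
have ontoPhi F : exists v, Phi v = F.
  have [u hu] := isometry_proj F linPhi PhiS; exists u; apply/esym/subr0_eq.
  by apply: L2_total => t m; rewrite -Phi_exp hu.
have PhiB u v : Phi (u - v) = Phi u - Phi v.
  by rewrite addrC -scaleN1r linPhi scaleN1r addrC.
have half v : Ep v -> L2half R M (Phi v).
  move=> Ev; apply/L2halfP => t m t0; rewrite !PhiE (flow0 gU).
  have [_ Mm] := shval_expspace m.
  rewrite dotC (dot_flowl gU) Mm ?oppr_ge0//.
  by rewrite opprK dotC.
exists M, Phi; split; first exact: unitary_of_dot.
- apply/seteqP; split=> [_ [v Ev <-]|F]; first exact: half.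
  have [v <-] := ontoPhi F => Fh; exists v => //.
  have [p [Epp orthp]] := projection_exists sEp cEp v.
  suff /subr0_eq -> : v - p = 0 by [].
  apply: sqn_eq0; rewrite -PhiS; suff -> : Phi (v - p) = 0 by rewrite sqn0.
  have pos t m : 0 <= t -> dot (Phi (v - p)) (expvec t m) = 0.
    move=> t0; rewrite PhiE; apply: orthp.
    by apply: (flow_sub gU Umono) => //; have [] := shval_expspace m.
  apply: L2_total => t m; have [t0|/ltW t0] := leP 0 t; first exact: pos.
  have e1 := (L2halfP _).1 Fh t m t0;
    have e2 := (L2halfP _).1 (half p Epp) t m t0.
  have := pos 0 m (lexx 0); rewrite PhiB !dotBl e1 e2 => e3.
  by rewrite -mulrBr e3 mulr0.
- move=> t v; apply: L2_ext => s m.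
  have -> : expvec s m = L2translate t (expvec (s - t) m).
    by rewrite L2translate_expvec addrC subrK.
  rewrite dot_translate PhiE L2translate_expvec PhiE (dot_flowl gU) -(flowD gU).
  by congr (dot v (U _ _)); ring.
Qed.

End Existence.

(** * Uniqueness of the outgoing realization *)

Section Uniqueness.
Context {R : realType} {E : hilbertType R} (Ep : set E) (U : R -> E -> E).
Context (sEp : submod_closed [in Ep]) (gU : unitary_one_parameter_group U).

Section Realization.
Context {N : hilbertType R} (Phi : E ->
  L2 N) (rPhi : outgoing_realization U Ep Phi).

Lemma realization_expspace v m : Phi v = expvec 0 m -> expspace Ep U v.
Proof.
have [uPhi halfPhi trPhi] := rPhi;
  have [linPhi isoPhi ontoPhi] := unitary_dot uPhi.
move=> Pv; have vh : L2half R N (Phi v).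
  apply/L2halfP => t m' t0; rewrite Pv !dot_expvec subrr normr0 oppr0 mul0r
    expR0 mul1r.
  by rewrite addr0 ler0_norm// opprK.
split.
  move: vh; rewrite -halfPhi => -[u Eu Pu].
  by rewrite -(isometry_inj linPhi isoPhi Pu).
move=> t z t0 Ez; rewrite -isoPhi trPhi Pv.
have -> : expvec 0 m = L2translate t (expvec (- t) m).
  by rewrite L2translate_expvec subrr.
have /L2halfP zh : L2half R N (Phi z) by rewrite -halfPhi; exists z.
rewrite dot_translate dotC zh ?oppr_le0//; congr (_ * _).
by rewrite -Pv isoPhi dotC.
Qed.

(** The candidate for m is the projection of Phi v onto the space of the e_0
    (x) d. Both sides then have the same inner products with every e_t (x) d,
    by [dot_expspace] in E and by [dot_expvec] in L2. *)
Lemma expspace_realization v : expspace Ep U v -> exists m, Phi v = expvec 0 m.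
Proof.
have [uPhi halfPhi trPhi] := rPhi;
  have [linPhi isoPhi ontoPhi] := unitary_dot uPhi.
move=> Mv.
have [m hm] := isometry_proj (Phi v) (@expvec_lin R N 0) (@sqn_expvec R N 0).
exists m; apply: L2_ext => t d.
have [y Py] := ontoPhi (expvec 0 d); have My := realization_expspace Py.
have e0 : dot (Phi v) (expvec 0 d) = dot m d.
  have /eqP := hm d; rewrite dotBl subr_eq0 => /eqP ->.
  by rewrite dot_expvec subrr normr0 oppr0 mul0r expR0 mul1r.
have -> : dot (Phi v) (expvec t d) = expR (- `|t| / 2) * dot v y.
  have -> : expvec t d = Phi (U t y) by rewrite trPhi Py L2translate_expvec
    addr0.
  by rewrite isoPhi -{1}[v](flow0 gU) (dot_expspace gU _ _ Mv My) subr0.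
by rewrite dot_expvec subr0 -e0 -Py isoPhi.
Qed.

End Realization.

Lemma dot_L2map (M N : hilbertType R) (V : M -> N) (F G : L2 M) : unitary V ->
  dot (L2map V F) (L2map V G) = dot F G.
Proof.
move=> uV; have [_ isoV _] := unitary_dot uV.
rewrite (dot_class2 (L2_pred_map uV (L2valP F)) (L2_pred_map uV (L2valP G))).
by rewrite dot_L2E; apply: eq_Rintegral => x _; exact: isoV.
Qed.

Lemma L2map_expvec (M N : hilbertType R) (V : M -> N) t m : unitary V ->
  L2map V (expvec t m) = expvec t (V m).
Proof.
move=> uV; have [linV isoV _] := unitary_dot uV.
rewrite L2map_class ?expfun_L2//; congr L2class; apply/funext => x.
have V0 : V 0 = 0 by apply: sqn_eq0; rewrite /sqn isoV dot0l.
by rewrite /expfun /= /rscale -[_ *: m in LHS]addr0 linV V0 addr0.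
Qed.

(** V sends m to the m' such that the same vector of E is represented by e_0
    (x) m and e_0 (x) m'. *)
Lemma outgoing_realization_unique (N N' : hilbertType R)
    (Phi : E -> L2 N) (Phi' : E -> L2 N') :
  outgoing_realization U Ep Phi -> outgoing_realization U Ep Phi' ->
  exists2 V : N -> N', unitary V & forall v, Phi' v = L2map V (Phi v).
Proof.
move=> rPhi rPhi'.
have [uPhi _ trPhi] := rPhi; have [linPhi isoPhi ontoPhi] := unitary_dot uPhi.
have [uPhi' _ trPhi'] := rPhi';
  have [linPhi' isoPhi' ontoPhi'] := unitary_dot uPhi'.
have injPhi := isometry_inj linPhi isoPhi.
have /choice[V hV] m : exists m', exists v, Phi v = expvec 0 m /\ Phi' v =
  expvec 0 m'.
  have [v Pv] := ontoPhi (expvec 0 m).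
  have [m' Pv'] := expspace_realization rPhi' (realization_expspace rPhi Pv).
  by exists m', v.
have VE m v : Phi v = expvec 0 m -> Phi' v = expvec 0 (V m).
  by move=> Pv; have [w [Pw Pw']] := hV m; rewrite -Pw'; congr Phi';
    apply: injPhi; rewrite Pv.
have uV : unitary V.
  apply: unitary_of_dot => [c m1 m2|m1 m2|m'].
  - have [v1 [P1 P1']] := hV m1; have [v2 [P2 P2']] := hV m2.
    apply: (@expvec_inj _ _ 0).
    by rewrite -(VE _ (c *: v1 + v2)) ?linPhi' ?linPhi ?expvec_lin ?P1 ?P2 ?P1'
      ?P2'.
  - have [v1 [P1 P1']] := hV m1; have [v2 [P2 P2']] := hV m2.
    have e0 (K : hilbertType R) (a b : K) : dot (expvec 0 a) (expvec 0 b) =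
      dot a b.
      by rewrite dot_expvec subrr normr0 oppr0 mul0r expR0 mul1r.
    by rewrite -e0 -P1' -P2' isoPhi' -isoPhi P1 P2 e0.
  - have [y Py] := ontoPhi' (expvec 0 m').
    have [m Pm] := expspace_realization rPhi (realization_expspace rPhi' Py).
    by exists m; apply: (@expvec_inj _ _ 0); rewrite -(VE _ _ Pm).
exists V => // v; apply: L2_ext => t m'.
have [_ _ ontoV] := unitary_dot uV; have [m <-] := ontoV m'.
have [w [Pw Pw']] := hV m.
rewrite -(L2map_expvec t m uV) dot_L2map//.
have -> : expvec t m = Phi (U t w) by rewrite trPhi Pw L2translate_expvec addr0.
have -> : L2map V (Phi (U t w)) = Phi' (U t w).
  by rewrite trPhi Pw trPhi' Pw' !L2translate_expvec L2map_expvec.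
by rewrite isoPhi isoPhi'.
Qed.

End Uniqueness.

Theorem proposition3p14 (R : realType) (E : hilbertType R) (Ep : set E)
    (theta : E -> E) (U : R -> E -> E) :
  reflection_positive_space Ep theta ->
  reflection_positive_group Ep theta U ->
  cyclic_subspace U Ep ->
  fixed_vectors U = [set 0] ->
  [/\ outgoing U Ep,
      exists (M : hilbertType R) (Phi : E -> L2 M),
        outgoing_realization U Ep Phi &
      forall (M M' : hilbertType R) (Phi : E -> L2 M) (Phi' : E -> L2 M'),
        outgoing_realization U Ep Phi -> outgoing_realization U Ep Phi' ->
        exists2 V : M -> M', unitary V & forall v, Phi' v = L2map V (Phi v)].
Proof.
move=> rE rU cU fU.
have [_ _ sEp cEp _] := rE; have [gU Umono _] := rU.
split; first exact: outgoingP rE rU cU fU.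
- apply: (outgoing_realization_exists sEp cEp gU Umono).
    exact: outgoing_LP2 rE rU cU fU.
  move=> v e e0; have [t [z [_ Ez vz]]] := dense_translates rE rU cU v e0.
  by exists t, z.
- by move=> M M' Phi Phi'; exact: (outgoing_realization_unique gU).
Qed.
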